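(* Let $k\ge 3$ and $0<\delta\le 1$ be fixed parameters. Suppose that $\nu:\mathbb{Z}_N\to\mathbb{R}^+$ is $k$-pseudorandom. Let $f:\mathbb{Z}_N\to\mathbb{R}^+$ be any non-negative function obeying $$0\le f(x)\le \nu(x)\quad\text{for all } x\in\mathbb{Z}_N \qquad\text{and}\qquad \mathbb{E}(f)\ge \delta .$$ Then $$\mathbb{E}\big(f(x)f(x+r)\cdots f(x+(k-1)r)\mid x,r\in\mathbb{Z}_N\big)\ \ge\ c(k,\delta)-o_{k,\delta}(1),$$ where $c(k,\delta)>0$ is the same constant as in Szemer\'edi's theorem for functions bounded by $1$ (as specified in the context). The decay rate $o_{k,\delta}(1)$ may depend on the decay rates and bounds in the linear forms and correlation conditions for $\nu$.
   Context: Conventions. $N$ denotes a prime, thought of as tending to infinity; $\mathbb{Z}_N=\mathbb{Z}/N\mathbb{Z}$; $\mathbb{R}^+$ is the set of non-negative reals. $\mathbb{E}(f(x)\mid P(x))$ is the average of $f$ over the (finite, non-empty) set of $x$ satisfying $P$, and $\mathbb{E}(f)$ is the average over the whole domain. All objects on $\mathbb{Z}_N$ may depend on $N$ (so $\nu$ is really a family $(\nu_N)$). $O(1)$ denotes a quantity bounded in magnitude and $o(1)$ one tending to $0$ as $N\to\infty$; bounds and rates may depend on $k$, on the rates and bounds in the conditions defining pseudorandomness of $\nu$, and on parameters displayed as subscripts, but are uniform in all other data. The constant $c(k,\delta)$. For $k\ge 1$ and $0<\delta\le 1$, $c(k,\delta)>0$ is a constant, independent of $f$ and $N$, for which Szemer\'edi's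 theorem holds in the following form: for every $f:\mathbb{Z}_N\to\mathbb{R}^+$ with $0\le f(x)\le 1$ for all $x$ and $\mathbb{E}(f)\ge\delta$ one has $\mathbb{E}(f(x)f(x+r)\cdots f(x+(k-1)r)\mid x,r\in\mathbb{Z}_N)\ge c(k,\delta)-o_{k,\delta}(1)$. (Such a constant exists by Szemer\'edi's theorem, which may be assumed.) Pseudorandomness. A measure is a function $\nu:\mathbb{Z}_N\to\mathbb{R}^+$ with $\mathbb{E}(\nu)=1+o(1)$. A measure $\nu$ satisfies the $(m_0,t_0,L_0)$-linear forms condition if the following holds: for all $m\le m_0$, $t\le t_0$, all rationals $L_{ij}$ ($1\le i\le m$, $1\le j\le t$) with numerator and denominator at most $L_0$ in absolute value such that the $t$-tuples $(L_{ij})_{1\le j\le t}\in\mathbb{Q}^t$ are non-zero and none is a rational multiple of any other, and all $b_1,\dots,b_m\in\mathbb{Z}_N$, setting $\psi_i(\mathbf{x})=\sum_{j=1}^t L_{ij}x_j+b_i$ (with $L_{ij}$ read as elements of $\mathbb{Z}_N$, $N>L_0$ prime), one has $\mathbb{E}(\nu(\psi_1(\mathbf{x}))\cdots\nu(\psi_m(\mathbf{x}))\mid \mathbf{x}\in\mathbb{Z}_N^t)=1+o_{L_0,m_0,t_0}(1)$, with decay rate uniform in $b_1,\dots,b_m$. A measure $\nu$ satisfies the $m_0$-correlation condition if for every $1<m\le m_0$ there is a function $\tau=\tau_m:\mathbb{Z}_N\to\mathbb{R}^+$ with $\mathbb{E}(\tau^q)=O_{m,q}(1)$ for all $1\le q<\infty$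 and $\mathbb{E}(\nu(x+h_1)\cdots\nu(x+h_m)\mid x\in\mathbb{Z}_N)\le\sum_{1\le i<j\le m}\tau(h_i-h_j)$ for all $h_1,\dots,h_m\in\mathbb{Z}_N$ (not necessarily distinct). A measure is $k$-pseudorandom if it satisfies the $(k\cdot 2^{k-1},3k-4,k)$-linear forms condition and the $2^{k-1}$-correlation condition. *)

(* Defs.v *)
From HB Require Import structures.
From mathcomp Require Import all_boot all_order all_algebra.
From mathcomp Require Import all_classical all_reals all_analysis.

Set Implicit Arguments.
Unset Strict Implicit.
Unset Printing Implicit Defensive.

Import Order.TTheory GRing.Theory Num.Theory.
Import numFieldNormedType.Exports.

Local Open Scope classical_set_scope.
Local Open Scope ring_scope.

(* For N prime, 'F_N is Z/NZ; for other N it is a different ring, so N is      *)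
(* assumed prime wherever it is quantified.                                    *)

Definition avg (R : realType) (T : finType) (F : T -> R) : R :=
  (\sum_(x : T) F x) / #|T|%:R.

Definition ap_avg (R : realType) (k N : nat) (f : 'F_N -> R) : R :=
  avg (fun xr : 'F_N * 'F_N => \prod_(j < k) f (xr.1 + xr.2 *+ j)).

Definition vanishing (R : realType) (e : nat -> R) : Prop :=
  e @ \oo --> (0 : R).

Definition szemeredi_constant (R : realType) (k : nat) (delta c : R) : Prop :=
  0 < c /\
  exists2 e : nat -> R, vanishing e &
    forall N : nat, prime N -> forall f : 'F_N -> R,
      (forall x, 0 <= f x <= 1) -> delta <= avg f -> c - e N <= ap_avg k f.

(* The predicates below concern a single N, and carry the o(1) rates           *)
(* e, e' : nat -> R and the O_{m,q}(1) bounds B : nat -> R -> R as parameters. *)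
(* A family (nu_N) is k-pseudorandom when, for some vanishing e and e' and     *)
(* some B, pseudorandom k e e' B nu_N holds for every prime N.                 *)

Definition measure_cond (R : realType) (e : nat -> R) (N : nat)
    (nu : 'F_N -> R) : Prop :=
  (forall x, 0 <= nu x) /\ `|avg nu - 1| <= e N.

(* numq and denq are the terms of the reduced fraction; any representation     *)
(* with terms bounded by L0 reduces to one with terms bounded by L0.           *)
Definition linear_forms_cond (R : realType) (m0 t0 L0 : nat) (e : nat -> R)
    (N : nat) (nu : 'F_N -> R) : Prop :=
  (L0 < N)%N ->
  forall m t : nat, (m <= m0)%N -> (t <= t0)%N ->
  forall L : 'M[rat]_(m, t),
    (forall i j, `|numq (L i j)| <= L0%:Z /\ `|denq (L i j)| <= L0%:Z) ->
    (forall i, row i L != 0) ->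
    (forall i i', i != i' -> forall a : rat, row i L != a *: row i' L) ->
  forall b : 'I_m -> 'F_N,
    `|avg (fun x : 'rV['F_N]_t =>
         \prod_(i < m) nu (\sum_(j < t) ratr (L i j) * x 0 j + b i)) - 1| <= e N.

Definition correlation_cond (R : realType) (m0 : nat) (B : nat -> R -> R)
    (N : nat) (nu : 'F_N -> R) : Prop :=
  forall m : nat, (1 < m <= m0)%N ->
  exists tau : 'F_N -> R,
    [/\ forall x, 0 <= tau x,
        forall q : R, 1 <= q -> avg (fun x => tau x `^ q) <= B m q
      & forall h : 'I_m -> 'F_N,
          avg (fun x => \prod_(i < m) nu (x + h i))
            <= \sum_(i < m) \sum_(j < m | (i < j)%N) tau (h i - h j)].

Definition pseudorandom (R : realType) (k : nat) (e e' : nat -> R)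
    (B : nat -> R -> R) (N : nat) (nu : 'F_N -> R) : Prop :=
  [/\ measure_cond e nu,
      linear_forms_cond (k * 2 ^ (k - 1)) (3 * k - 4) k e' nu
    & correlation_cond (2 ^ (k - 1)) B nu].

(* Main.v *)
(* Transference by densification, after Conlon, Fox and Zhao. Let f <= nu.     *)
(* The test functions y |-> E(prod_i u_i(x) | sum_i i x_i = y), with u_i       *)
(* independent of x_i, are closed under products up to averaging, and nu - 1   *)
(* is nearly orthogonal to them by repeated Cauchy-Schwarz and the linear      *)
(* forms condition. Hence f has a dense model ft with values in [0, 1] that no *)
(* test function distinguishes from f. The progression averages of f and ft    *)
(* are then compared by replacing the factors one at a time: the product of    *)
(* the other factors, averaged over the missing variable, is bounded by an     *)
(* average of nu's that is close to 1 in L2, so the weight nu of the current   *)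
(* factor can be exchanged for 1. Szemeredi's theorem applies to ft.           *)

Require Import Defs.
From HB Require Import structures.
From mathcomp Require Import all_boot all_order all_algebra.
From mathcomp Require Import all_classical all_reals all_analysis.
From mathcomp Require Import perm ring lra zify.

Set Implicit Arguments.
Unset Strict Implicit.
Unset Printing Implicit Defensive.

Import Order.TTheory GRing.Theory Num.Theory.
Import numFieldNormedType.Exports.

Local Open Scope ring_scope.

(** * Averages over finite types *)

(** Progressions are counted on the system of all x in G^k, G = ['F_N], where the j-th term
    [psi j x] ignores the coordinate [x j] ([ap_avg_psi]). The linear forms condition enters as
    [cube_forms]: products of [nu] over distinct forms [psi j], taken at the vertices of a doubled
    cube, average to nearly 1. One Cauchy-Schwarz step per coordinate other than [j] then shows that
    [nu - 1] is nearly orthogonal to products of functions that each ignore a coordinate, even if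
    these are bounded by [nu] instead of 1 ([weighted_forms_small]).

    This estimate is used twice. For bounded functions it makes [dense_model] applicable to the
    tests ([test_nu_small], [is_test_mul]); for functions bounded by [nu] it drives [densification],
    the inductive step of [counting_lemma]. [transference] combines the two. *)

Section Averages.
Variable R : realType.
Implicit Types S T : finType.

Lemma eq_avg T (F G : T -> R) : F =1 G -> avg F = avg G.
Proof. by move=> FG; rewrite /avg (eq_bigr G). Qed.

Lemma avgD T (F G : T -> R) : avg (fun x => F x + G x) = avg F + avg G.
Proof. by rewrite /avg big_split mulrDl. Qed.

Lemma avgZ T (c : R) (F : T -> R) : avg (fun x => c * F x) = c * avg F.
Proof. by rewrite /avg -mulr_sumr mulrA. Qed.

Lemma avgB T (F G : T -> R) : avg (fun x => F x - G x) = avg F - avg G.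
Proof. by rewrite /avg sumrB mulrBl. Qed.

Lemma avg_cst T (c : R) : (0 < #|T|)%N -> avg (fun _ : T => c) = c.
Proof.
move=> T0; rewrite /avg sumr_const -[c *+ _]mulr_natr mulfK//.
by rewrite pnatr_eq0 -lt0n.
Qed.

Lemma avg_sum T (I : Type) (r : seq I) (P : pred I) (F : I -> T -> R) :
  avg (fun x => \sum_(i <- r | P i) F i x) = \sum_(i <- r | P i) avg (F i).
Proof. by rewrite /avg exchange_big/= mulr_suml. Qed.

Lemma le_avg T (F G : T -> R) : (forall x, F x <= G x) -> avg F <= avg G.
Proof.
by move=> FG; rewrite /avg ler_wpM2r ?invr_ge0 ?ler0n// ler_sum.
Qed.

Lemma avg_ge0 T (F : T -> R) : (forall x, 0 <= F x) -> 0 <= avg F.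
Proof.
by move=> F0; rewrite /avg mulr_ge0 ?invr_ge0 ?ler0n// sumr_ge0.
Qed.

Lemma ler_norm_avg T (F : T -> R) : `|avg F| <= avg (fun x => `|F x|).
Proof.
rewrite /avg normrM [X in _ * X]ger0_norm ?invr_ge0 ?ler0n//.
by rewrite ler_wpM2r ?invr_ge0 ?ler0n// ler_norm_sum.
Qed.

Lemma avg_norm_le T (F : T -> R) (c : R) : 0 <= c ->
  (forall x, `|F x| <= c) -> `|avg F| <= c.
Proof.
move=> c0 Fc; apply: le_trans (ler_norm_avg _) _.
have [T0|] := posnP #|T|; last first.
  by move=> T0; rewrite -[leRHS](avg_cst c T0) le_avg.
by rewrite /avg big1 ?mul0r// => x; have := max_card (pred1 x); rewrite card1 T0.
Qed.

Lemma avg_exchange S T (F : S -> T -> R) :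
  avg (fun x => avg (F x)) = avg (fun y => avg (F^~ y)).
Proof.
rewrite /avg -!mulr_suml exchange_big/= -!mulrA; congr (_ * _); exact: mulrC.
Qed.

Lemma avg_pair S T (F : S * T -> R) :
  avg F = avg (fun x => avg (fun y => F (x, y))).
Proof.
rewrite /avg -mulr_suml pair_bigA/= card_prod natrM invfM mulrA.
by rewrite mulrAC; congr (_ / _ / _); apply: eq_bigr => -[].
Qed.

Lemma avg_mul S T (F : S -> R) (G : T -> R) :
  avg F * avg G = avg (fun x => avg (fun y => F x * G y)).
Proof.
rewrite -[LHS]mulrC -avgZ; apply: eq_avg => x; rewrite avgZ; exact: mulrC.
Qed.

Lemma avg_reindex S T (h : S -> T) (F : T -> R) :
  bijective h -> avg F = avg (F \o h).
Proof.
move=> hb; rewrite /avg (reindex h)/=; last exact: onW_bij.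
by rewrite (bij_eq_card hb).
Qed.

Lemma avg_involutive T (h : T -> T) (F : T -> R) :
  involutive h -> avg F = avg (F \o h).
Proof. by move=> hK; apply: avg_reindex; exists h. Qed.

(* Discriminant of the nonnegative quadratic [t |-> avg (w * (b - t) ^+ 2)].   *)
Lemma avg_CS T (w b : T -> R) : (forall x, 0 <= w x) ->
  avg (fun x => w x * b x) ^+ 2 <= avg w * avg (fun x => w x * b x ^+ 2).
Proof.
move=> w0; set A := avg w; set B := avg _; set C := avg _.
have A0 : 0 <= A by apply: avg_ge0.
have C0 : 0 <= C by apply: avg_ge0 => x; rewrite mulr_ge0 ?sqr_ge0.
have key t : 0 <= C - 2 * t * B + t ^+ 2 * A.
  rewrite -2!avgZ -avgB -avgD; apply: avg_ge0 => x.
  suff -> : w x * b x ^+ 2 - 2 * t * (w x * b x) + t ^+ 2 * w x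
    = w x * (b x - t) ^+ 2 by rewrite mulr_ge0 ?sqr_ge0.
  by ring.
have [A_eq0|A_neq0] := eqVneq A 0.
  suff -> : B = 0 by rewrite expr0n mulr_ge0.
  apply/eqP; apply: contraT => B0.
  have := key ((C + 1) / (2 * B)); rewrite A_eq0 mulr0 addr0.
  have -> : 2 * ((C + 1) / (2 * B)) * B = C + 1 by field.
  lra.
have Ap : 0 < A by rewrite lt_neqAle eq_sym A_neq0.
have := key (B / A).
have -> : C - 2 * (B / A) * B + (B / A) ^+ 2 * A = (A * C - B ^+ 2) / A.
  by field.
by rewrite pmulr_lge0 ?invr_gt0// subr_ge0.
Qed.

Lemma avg_norm_CS T (F : T -> R) : (0 < #|T|)%N ->
  avg (fun x => `|F x|) ^+ 2 <= avg (fun x => F x ^+ 2).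
Proof.
move=> T0; have := @avg_CS _ (fun=> 1) (fun x => `|F x|) (fun=> ler01).
rewrite (avg_cst 1 T0) mul1r (eq_avg (fun=> mul1r _)).
by rewrite (eq_avg (fun=> mul1r _)) (eq_avg (fun=> real_normK (num_real _))).
Qed.

(** Translating by all [y] leaves the average over [X] unchanged and makes the image run uniformly
    over [Y]. The surjective linear maps below are handled this way: [trX y] adds a preimage of [y],
    and no fibre has to be counted. *)
Lemma avg_equidistributed (X Y : finType) (L : X -> Y)
    (trX : Y -> X -> X) (trY : Y -> Y -> Y) (F : Y -> R) :
  (0 < #|X|)%N ->
  (forall y, injective (trX y)) -> (forall y, injective (trY^~ y)) ->
  (forall x y, L (trX y x) = trY y (L x)) ->
  avg (F \o L) = avg F.
Proof.
move=> X0 injX injY Ltr.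
have cY : (0 < #|Y|)%N by case/card_gt0P: X0 => x _; apply/card_gt0P; exists (L x).
rewrite -(avg_cst (avg (F \o L)) cY).
rewrite (@eq_avg _ _ (fun y => avg (fun x => F (trY y (L x))))).
  rewrite avg_exchange -[RHS](avg_cst _ X0); apply: eq_avg => x.
  by rewrite [RHS](avg_reindex _ (h := trY^~ (L x)))//; exact: injF_bij.
move=> y; rewrite (avg_reindex _ (h := trX y)); last exact: injF_bij.
by apply: eq_avg => x /=; rewrite Ltr.
Qed.

End Averages.

(** * Coordinates and their duplication *)

Section Coordinates.
Variables (R : realType) (I T : finType).
Implicit Types (x : {ffun I -> T}) (p q : I) (t : T).

Definition upd x p t : {ffun I -> T} := [ffun i => if i == p then t else x i].

Definition indep p (u : {ffun I -> T} -> R) := forall x t, u (upd x p t) = u x.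

Lemma upd_id x p : upd x p (x p) = x.
Proof. by apply/ffunP => i; rewrite ffunE; case: eqP => // ->. Qed.

Lemma upd_upd x p t t' : upd (upd x p t) p t' = upd x p t'.
Proof. by apply/ffunP => i; rewrite !ffunE; case: eqP. Qed.

Lemma updC x p q t t' : p != q -> upd (upd x p t) q t' = upd (upd x q t') p t.
Proof.
move=> pq; apply/ffunP => i; rewrite !ffunE.
by case: (eqVneq i q) => // ->; rewrite eq_sym (negPf pq).
Qed.

Lemma updE x p t : upd x p t p = t.
Proof. by rewrite ffunE eqxx. Qed.

Lemma indepM p u v : indep p u -> indep p v -> indep p (fun x => u x * v x).
Proof. by move=> up vp x t; rewrite up vp. Qed.

Definition fiber_avg p (u : {ffun I -> T} -> R) x := avg (fun t => u (upd x p t)).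

Lemma indep_fiber_avg p u : indep p (fiber_avg p u).
Proof. by move=> x t; apply: eq_avg => t'; rewrite upd_upd. Qed.

Hypothesis T0 : (0 < #|T|)%N.

Lemma avg_fiber p (u : {ffun I -> T} -> R) : avg (fiber_avg p u) = avg u.
Proof.
transitivity (avg (fun xt : {ffun I -> T} * T => u (upd xt.1 p xt.2))).
  by rewrite avg_pair.
rewrite (avg_involutive (h := fun xt => (upd xt.1 p xt.2, xt.1 p))).
  by rewrite avg_pair; apply: eq_avg => x; rewrite -[RHS](avg_cst _ T0);
    apply: eq_avg => t /=; rewrite upd_upd upd_id.
by case=> x t /=; rewrite upd_upd upd_id updE.
Qed.

Lemma avg_fiberM p (u v : {ffun I -> T} -> R) : indep p u ->
  avg (fun x => u x * fiber_avg p v x) = avg (fun x => u x * v x).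
Proof.
move=> up; rewrite -[RHS](avg_fiber p); apply: eq_avg => x.
by rewrite -avgZ; apply: eq_avg => t; rewrite up.
Qed.

(** Cauchy-Schwarz with weight [w] produces the square of the average of [b] over coordinate [p].
    Since [w] and [b] ignore coordinate [q], it can hold the second copy of coordinate [p]. *)
Lemma avg_CS_double p q (w a b : {ffun I -> T} -> R) : p != q ->
  (forall x, `|a x| <= w x) -> indep p w -> indep q w -> indep p a ->
  indep q b ->
  avg (fun x => a x * b x) ^+ 2
    <= avg w * avg (fun x => w x * (b x * b (upd x p (x q)))).
Proof.
move=> pq aw wp wq ap bq.
have w0 x : 0 <= w x by apply: le_trans (aw x).
suff -> : avg (fun x => w x * (b x * b (upd x p (x q))))
    = avg (fun x => w x * `|fiber_avg p b x| ^+ 2).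
  apply: le_trans (avg_CS _ w0); rewrite -(avg_fiberM b ap).
  rewrite -[leLHS]real_normK ?num_real// lerXn2r ?nnegrE ?avg_ge0// => [x|].
    by rewrite mulr_ge0.
  apply: le_trans (ler_norm_avg _) _; apply: le_avg => x.
  by rewrite normrM ler_wpM2r.
rewrite -(avg_fiber q); transitivity
    (avg (fun x => (w x * fiber_avg p b x) * b x)).
  apply: eq_avg => x; rewrite mulrAC -avgZ; apply: eq_avg => t.
  by rewrite updE wq bq [upd (upd _ _ _) _ _]updC 1?eq_sym// bq mulrA.
have := avg_fiberM b (indepM wp (@indep_fiber_avg p b)) => <-.
by apply: eq_avg => x; rewrite real_normK ?num_real// -mulrA -expr2.
Qed.

End Coordinates.

Lemma prod_powersetU1 (R : comPzRingType) (I : finType) (p : I) (s : {set I})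
    (F : {set I} -> R) : p \notin s ->
  \prod_(a in powerset (p |: s)) F a
    = \prod_(a in powerset s) (F a * F (p |: a)).
Proof.
move=> ps; rewrite (bigID (fun a : {set I} => p \in a))/= mulrC big_split/=.
congr (_ * _).
  apply: eq_bigl => a; rewrite !inE.
  apply/andP/idP => [[/fintype.subsetP aps pa]|/fintype.subsetP aps].
    apply/fintype.subsetP => i ia; have := aps i ia; rewrite !inE => /orP[/eqP ip|//].
    by rewrite -ip ia in pa.
  split; first by apply/fintype.subsetP => i /aps; rewrite !inE orbC => ->.
  by apply: contra ps => /aps.
rewrite (reindex_onto (fun a => p |: a) (fun a => a :\ p))/=; last first.
  by move=> a /andP[_ pa]; rewrite finset.setD1K.
apply: eq_bigl => a; rewrite !inE eqxx/= andbT.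
apply/andP/fintype.subsetP => [[/fintype.subsetP aps /eqP ae] i ia|aps].
  have := aps i; rewrite !inE ia orbT => /(_ isT) /orP[/eqP ip|//].
  by move: ia; rewrite -ae !inE ip eqxx.
have pa : p \notin a by apply: contra ps => /aps.
split; last by rewrite finset.setU1K.
by apply/fintype.subsetP => i; rewrite !inE => /orP[->//|/aps ->]; rewrite orbT.
Qed.

Section Doubling.
Variables (R : realType) (I T : finType).
Implicit Types (s a : {set I}) (z : {ffun I * bool -> T}).

(* [z] encodes two points [z (_, false)] and [z (_, true)]; [mix s z] takes    *)
(* the coordinates in [s] from the second one.                                 *)
Definition mix s z : {ffun I -> T} := [ffun i => z (i, i \in s)].

Lemma mix_upd0 s p z t : p \notin s ->
  mix s (upd z (p, false) t) = upd (mix s z) p t.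
Proof.
move=> ps; apply/ffunP => i; rewrite !ffunE xpair_eqE.
by case: (eqVneq i p) => //= ->; rewrite (negPf ps).
Qed.

Lemma mix_upd1 s p z t : p \notin s -> mix s (upd z (p, true) t) = mix s z.
Proof.
move=> ps; apply/ffunP => i; rewrite !ffunE xpair_eqE.
by case: (eqVneq i p) => //= ->; rewrite (negPf ps).
Qed.

Lemma upd_mix s p z : upd (mix s z) p (z (p, true)) = mix (p |: s) z.
Proof.
by apply/ffunP => i; rewrite !ffunE !inE; case: (eqVneq i p) => // ->.
Qed.

End Doubling.

(** * Iterated Cauchy-Schwarz inequality *)

Section GowersCauchySchwarz.
Variables (R : realType) (I T : finType) (j : I).
Hypothesis T0 : (0 < #|T|)%N.
Implicit Types (s a : {set I}) (z : {ffun I * bool -> T}) (p i : I).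
Notation kernel := ({ffun I -> T} -> {ffun I -> T} -> R).

Definition indep2 p (v : kernel) :=
  forall x y t t', v (upd x p t) (upd y p t') = v x y.

(** Coordinate [j] is doubled from the start: the two arguments differ only there. *)
Definition pull (v : kernel) a z := v (mix a z) (mix (j |: a) z).

Lemma pull_upd1 v a p z t : p != j -> p \notin a ->
  pull v a (upd z (p, true) t) = pull v a z.
Proof.
by move=> pj pa; rewrite /pull !mix_upd1// !inE negb_or pj.
Qed.

Lemma pull_upd0 v a p z : p != j -> p \notin a ->
  pull v a (upd z (p, false) (z (p, true))) = pull v (p |: a) z.
Proof.
move=> pj pa; rewrite /pull !mix_upd0//; last by rewrite !inE negb_or pj.
by rewrite !upd_mix finset.setUCA.
Qed.

Lemma pull_indep v a p z t : indep2 p v -> p != j -> p \notin a ->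
  pull v a (upd z (p, false) t) = pull v a z.
Proof.
move=> vp pj pa; rewrite /pull !mix_upd0 ?vp//.
by rewrite !inE negb_or pj.
Qed.

Variables (F : kernel) (P Q : I -> kernel).

(* The coordinates in [s] have been duplicated: each [P i] with [i \in s] has  *)
(* been traded for its majorant [Q i], the others occur once per vertex of the *)
(* cube over [s].                                                              *)
Definition cs_level s : R :=
  avg (fun z =>
    (\prod_(a in powerset s)
       (pull F a z * \prod_(i | i \notin j |: s) pull (P i) a z))
    * \prod_(i in s) \prod_(a in powerset (s :\ i)) pull (Q i) a z).

Hypothesis PQ : forall i, i != j -> forall x y, `|P i x y| <= Q i x y.
Hypothesis P_indep : forall i, i != j -> indep2 i (P i).
Hypothesis Q_indep : forall i, i != j -> indep2 i (Q i).

(** The factors [P p] ignore coordinate [(p, false)], so they come out and are majorized by [Q p].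
    Every remaining factor at a vertex [a] acquires a twin at [p |: a], with [(p, true)] as the
    spare coordinate. *)
Lemma cs_level_step s p : p \notin j |: s ->
  cs_level s ^+ 2
    <= avg (fun z => \prod_(a in powerset s) pull (Q p) a z)
       * cs_level (p |: s).
Proof.
move=> pjs; have [pj ps] : p != j /\ p \notin s.
  by move: pjs; rewrite !inE negb_or => /andP.
have pa a : a \in powerset s -> p \notin a.
  by rewrite inE => /fintype.subsetP as_; apply: contra ps => /as_.
pose H a z := pull F a z * \prod_(i | i \notin j |: (p |: s)) pull (P i) a z.
pose K i z := \prod_(a in powerset (s :\ i)) pull (Q i) a z.
pose b z := (\prod_(a in powerset s) H a z) * \prod_(i in s) K i z.
have pa' i a : a \in powerset (s :\ i) -> p \notin a.
  rewrite inE => /fintype.subsetP as_; apply: contra ps => /as_.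
  by rewrite !inE => /andP[].
have -> : cs_level s
    = avg (fun z => (\prod_(a in powerset s) pull (P p) a z) * b z).
  apply: eq_avg => z; rewrite /b mulrA -big_split/=; congr (_ * _).
  apply: eq_bigr => a _; rewrite (bigD1 p)//= mulrCA; congr (_ * (_ * _)).
  by apply: eq_bigl => i; rewrite !inE !negb_or andbAC -andbA; congr (_ && _).
have -> : cs_level (p |: s)
    = avg (fun z => (\prod_(a in powerset s) pull (Q p) a z)
        * (b z * b (upd z (p, false) (z (p, true))))).
  apply: eq_avg => z; rewrite prod_powersetU1// big_split/=.
  rewrite big_setU1//= finset.setU1K//.
  have -> : \prod_(i in s) \prod_(a in powerset ((p |: s) :\ i)) pull (Q i) a z
      = \prod_(i in s) K i z
        * \prod_(i in s) K i (upd z (p, false) (z (p, true))).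
    rewrite -big_split/=; apply: eq_bigr => i si.
    have ip : p != i by apply: contraNneq ps => ->.
    have -> : (p |: s) :\ i = p |: (s :\ i).
      by apply/setP => l; rewrite !inE; case: (eqVneq l p) => // ->; rewrite ip.
    rewrite prod_powersetU1 ?inE ?(negPf ps) ?andbF// big_split/=.
    by congr (_ * _); apply: eq_bigr => a /pa' ha; rewrite pull_upd0.
  have -> : \prod_(a in powerset s) (pull F (p |: a) z *
        \prod_(i | i \notin j |: (p |: s)) pull (P i) (p |: a) z)
      = \prod_(a in powerset s) H a (upd z (p, false) (z (p, true))).
    apply: eq_bigr => a /pa ha; rewrite /H pull_upd0//; congr (_ * _).
    by apply: eq_bigr => i _; rewrite pull_upd0.
  by rewrite /b /H; ring.
apply: avg_CS_double => //.
- by rewrite xpair_eqE andbF.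
- move=> z; rewrite normr_prod; apply: ler_prod => a _.
  by rewrite normr_ge0 PQ.
- move=> z t; apply: eq_bigr => a /pa ha; rewrite pull_indep//; exact: Q_indep.
- by move=> z t; apply: eq_bigr => a /pa ha; rewrite pull_upd1.
- move=> z t; apply: eq_bigr => a /pa ha; rewrite pull_indep//; exact: P_indep.
- move=> z t; rewrite /b; congr (_ * _).
    apply: eq_bigr => a /pa ha; rewrite /H pull_upd1//; congr (_ * _).
    by apply: eq_bigr => i _; rewrite pull_upd1.
  by apply: eq_bigr => i _; apply: eq_bigr => a /pa' ha; rewrite pull_upd1.
Qed.

(** In units of [C], each step squares the lower bound, as the weight split off by [cs_level_step]
    averages to at most [C]. *)
Lemma cs_level_iter (C : R) s : 0 < C -> j \notin s ->
  (forall p s', p \notin j |: s' -> j \notin s' ->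
     avg (fun z => \prod_(a in powerset s') pull (Q p) a z) <= C) ->
  C * (`|cs_level finset.set0| / C) ^+ (2 ^ #|s|) <= `|cs_level s|.
Proof.
move=> C0 js QC; have [n] := ubnP #|s|; elim: n s js => // n IHn s js sn.
have [->|[p ps]] := set_0Vmem s; first by rewrite cards0 expr1 mulrC divfK// gt_eqF.
have js' : j \notin s :\ p by rewrite !inE negb_and js orbT.
have pjs : p \notin j |: s :\ p.
  by rewrite !inE eqxx orbF; apply: contraNneq js => <-.
rewrite (cardsD1 p) ps add1n ltnS in sn.
have := IHn _ js' sn; rewrite [in X in _ -> X](cardsD1 p) ps add1n expnS.
rewrite mulnC exprM; set A := _ ^+ _; set L := cs_level _.
have A0 : 0 <= A by rewrite exprn_ge0// divr_ge0// ltW.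
move=> CAL; rewrite -(ler_pM2l C0); apply: (@le_trans _ _ (`|L| ^+ 2)).
  rewrite (_ : C * (C * A ^+ 2) = (C * A) ^+ 2); last by ring.
  by rewrite lerXn2r ?nnegrE// mulr_ge0// ltW.
rewrite real_normK ?num_real//.
apply: le_trans (cs_level_step pjs) _; rewrite finset.setD1K//.
apply: le_trans (ler_norm _) _; rewrite normrM ler_wpM2r// ger0_norm ?QC//.
apply: avg_ge0 => z; apply: prodr_ge0 => a _; apply: le_trans (PQ _ _ _) => //.
by apply: contraNneq js => <-.
Qed.

End GowersCauchySchwarz.

(** * Linear forms on a doubled cube *)

Section LinearForms.
Variables (R : realType) (k : nat) (G : finFieldType).
Implicit Types (i j p : 'I_k) (x y : {ffun 'I_k -> G}) (s a : {set 'I_k}).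
Implicit Types (z : {ffun 'I_k * bool -> G}) (nu : G -> R).

(* [psi j x = a + j * r] with [a = \sum_i i * x i] and [r = - \sum_i x i],     *)
(* parametrized so that the [j]-th term does not depend on [x j].              *)
Definition psi j x : G := \sum_(i < k) (i%:R - j%:R) * x i.

Lemma psi_indep j x t : psi j (upd x j t) = psi j x.
Proof.
apply: eq_bigr => i _; rewrite ffunE.
by case: eqVneq => // ->; rewrite subrr !mul0r.
Qed.

(** As [psi j] ignores coordinate [j], the pairs [(j, a)] and [(j, j |: a)] name the same form; this
    keeps one name for each. *)
Definition admissible (X : {set 'I_k * {set 'I_k}}) :=
  forall u, u \in X -> u.1 \notin u.2.

Definition cube_value nu (u : 'I_k * {set 'I_k}) z := nu (psi u.1 (mix u.2 z)).

Definition cube_forms nu (eps : R) := forall X, admissible X ->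
  `|avg (fun z => \prod_(u in X) cube_value nu u z) - 1| <= eps.

(* Expanding [\prod_(u in D) (cube_value nu u z - 1)] one factor at a time: all *)
(* the main terms cancel unless [D] is empty.                                  *)
Lemma cube_forms_balanced nu eps (D W : {set 'I_k * {set 'I_k}}) :
  cube_forms nu eps -> admissible D -> admissible W ->
  (forall u, u \in D -> u \notin W) ->
  `|avg (fun z => (\prod_(u in D) (cube_value nu u z - 1))
                  * \prod_(u in W) cube_value nu u z) - (D == finset.set0)%:R|
    <= 2 ^+ #|D| * eps.
Proof.
move=> nuP; have [n] := ubnP #|D|; elim: n D W => // n IHn D W Dn aD aW DW.
have [->|[u uD]] := set_0Vmem D.
  rewrite cards0 expr0 mul1r eqxx.
  by rewrite (eq_avg (G := fun z => \prod_(u in W) cube_value nu u z)) ?nuP// => z;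
    rewrite big_set0 mul1r.
have uW : u \notin W by exact: DW.
have aD' : admissible (D :\ u) by move=> v; rewrite inE => /andP[_ /aD].
have aW' : admissible (u |: W).
  by move=> v; rewrite !inE => /predU1P[->|/aW//]; exact: aD.
have DW' v : v \in D :\ u -> v \notin W by rewrite inE => /andP[_ /DW].
have DW'' v : v \in D :\ u -> v \notin u |: W.
  by rewrite !inE => /andP[vu /DW vW]; rewrite negb_or vu.
have Dn' : (#|D :\ u| < n)%N by move: Dn; rewrite (cardsD1 u) uD.
rewrite (negPf (_ : D != _)); last by apply/set0Pn; exists u.
rewrite (cardsD1 u D) uD add1n exprS -mulrA mulr_natl mulr2n subr0.
set c := (D :\ u == finset.set0)%:R : R.
rewrite (eq_avg (G := fun z =>
   (\prod_(v in D :\ u) (cube_value nu v z - 1))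
       * (\prod_(v in u |: W) cube_value nu v z)
   - (\prod_(v in D :\ u) (cube_value nu v z - 1))
       * \prod_(v in W) cube_value nu v z)); last first.
  by move=> z; rewrite (big_setD1 u uD)/= (big_setU1 _ uW)/=; ring.
rewrite avgB; have := IHn _ _ Dn' aD' aW' DW''; have := IHn _ _ Dn' aD' aW DW'.
rewrite -/c => le2 le1; apply: le_trans (lerD le1 le2).
by apply: le_trans (ler_normB _ _); rewrite opprB addrA subrK.
Qed.

Definition wt nu s i x : R := if i \in s then nu (psi i x) else 1.

Lemma wt_indep nu s i : indep i (wt nu s i).
Proof. by move=> x t; rewrite /wt psi_indep. Qed.

Definition pairs (S : {set 'I_k}) (U : 'I_k -> {set 'I_k})
    (sel : {set 'I_k} -> {set 'I_k}) :=
  [set u : 'I_k * {set 'I_k} |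
    [&& u.1 \in S, u.2 \subset U u.1 & u.1 \in sel u.2]].

Lemma prod_pairs (f : 'I_k * {set 'I_k} -> R) (S : {set 'I_k})
    (U : 'I_k -> {set 'I_k}) (sel : {set 'I_k} -> {set 'I_k}) :
  \prod_(i in S) \prod_(a in powerset (U i)) (if i \in sel a then f (i, a) else 1)
  = \prod_(u in pairs S U sel) f u.
Proof.
rewrite pair_big_dep/= -big_mkcondr/=; apply: eq_big => [u|[]//].
by rewrite !inE -andbA.
Qed.

(** Duplicating every coordinate but [j] trades the unknown [a] and [b] for their majorants; what
    remains is a product of factors [nu - 1] and [nu] over distinct forms, small by
    [cube_forms_balanced]. The 2 on the left bounds the averages [1 + eps] of the weights split off
    on the way. *)
Lemma weighted_forms_bound nu eps j s1 s2
    (a b : 'I_k -> {ffun 'I_k -> G} -> R) :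
  cube_forms nu eps -> eps <= 1 ->
  (forall i, i != j -> forall x, `|a i x| <= wt nu s1 i x) ->
  (forall i, i != j -> forall x, `|b i x| <= wt nu s2 i x) ->
  (forall i, i != j -> indep i (a i)) -> (forall i, i != j -> indep i (b i)) ->
  2 * (`|avg (fun z => (nu (psi j (mix finset.set0 z)) - 1) *
          \prod_(i | i != j) (a i (mix finset.set0 z) * b i (mix [set j] z)))|
        / 2) ^+ (2 ^ k.-1)
  <= 2 ^+ #|{: 'I_k * {set 'I_k}}| * eps.
Proof.
move=> nuP eps1 aw bw ai bi.
have G0 : (0 < #|G|)%N by apply/card_gt0P; exists 0.
pose F x y := nu (psi j x) - 1.
pose P i x y := a i x * b i y.
pose Q i x y := wt nu s1 i x * wt nu s2 i y.
pose sel (c : {set 'I_k}) := if j \in c then s2 else s1.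
have PQ i : i != j -> forall x y, `|P i x y| <= Q i x y.
  by move=> ij x y; rewrite normrM ler_pM// ?aw ?bw.
have Pi i : i != j -> indep2 i (P i) by move=> ij x y t t'; rewrite /P ai// bi.
have Qi i : i != j -> indep2 i (Q i).
  by move=> ij x y t t'; rewrite /Q !wt_indep.
have prodQ i s z : j \notin s -> \prod_(c in powerset s) pull j (Q i) c z
    = \prod_(c in powerset (j |: s)) wt nu (sel c) i (mix c z).
  move=> js; rewrite prod_powersetU1//; apply: eq_bigr => c.
  rewrite inE => /fintype.subsetP cs; rewrite /pull /Q /sel !inE eqxx/=.
  by rewrite (negPf (_ : j \notin c))//; apply: contra js => /cs.
have QC p s : p \notin j |: s -> j \notin s ->
    avg (fun z => \prod_(c in powerset s) pull j (Q p) c z) <= 2.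
  move=> pjs js; set W := pairs [set p] (fun=> j |: s) sel.
  have aW : admissible W.
    move=> u; rewrite !inE => /and3P[/eqP -> /fintype.subsetP us _].
    by apply: contra pjs => /us.
  have := nuP W aW; rewrite (eq_avg (G := fun z =>
      \prod_(c in powerset s) pull j (Q p) c z)).
    rewrite ler_norml; lra.
  by move=> z; rewrite prodQ// -(prod_pairs (cube_value nu ^~ z)) big_set1.
have jC : j \notin ~: [set j] by rewrite !inE negbK.
have := cs_level_iter G0 F PQ Pi Qi (ltr0Sn R 1) jC QC.
rewrite cardsC1 card_ord.
have -> : cs_level j F P Q finset.set0 =
  avg (fun z => (nu (psi j (mix finset.set0 z)) - 1) *
          \prod_(i | i != j) (a i (mix finset.set0 z) * b i (mix [set j] z))).
  apply: eq_avg => z; rewrite powerset0 big_set1 big_set0 mulr1.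
  rewrite /pull /F finset.setU0; congr (_ * _).
  by apply: eq_bigl => i; rewrite !inE.
move=> le1; apply: (le_trans le1).
(* [D] lists the factors [nu - 1], all at index [j]; [W] lists the majorant weights, at the other
   indices. *)
pose D := pairs [set j] (fun=> ~: [set j]) (fun=> finset.setT).
pose W := pairs (~: [set j]) (fun i => ~: [set i]) sel.
have aD : admissible D.
  move=> u; rewrite !inE => /and3P[/eqP -> /fintype.subsetP us _].
  by apply/negP => /us; rewrite !inE eqxx.
have aW : admissible W.
  move=> u; rewrite !inE => /and3P[_ /fintype.subsetP us _].
  by apply/negP => /us; rewrite !inE eqxx.
have DW u : u \in D -> u \notin W.
  by rewrite !inE => /and3P[-> _ _].
have D0 : D != finset.set0.
  by apply/set0Pn; exists (j, finset.set0); rewrite !inE eqxx finset.sub0set.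
have := cube_forms_balanced nuP aD aW DW; rewrite (negPf D0) subr0.
have -> : cs_level j F P Q (~: [set j]) =
   avg (fun z => (\prod_(u in D) (cube_value nu u z - 1))
                  * \prod_(u in W) cube_value nu u z).
  apply: eq_avg => z; rewrite -(prod_pairs (cube_value nu ^~ z)).
  rewrite -(prod_pairs (fun u => cube_value nu u z - 1)); congr (_ * _).
    rewrite big_set1; apply: eq_bigr => c; rewrite !inE => cj.
    rewrite /pull /F [X in _ * X]big_pred0 ?mulr1// => i.
    by rewrite !inE orbN.
  apply: eq_bigr => i; rewrite !inE => ij.
  rewrite prodQ ?inE ?eqxx ?andbF//.
  suff -> : j |: ~: [set j] :\ i = ~: [set i] by [].
  by apply/setP => l; rewrite !inE; case: (eqVneq l j) => [->|]; rewrite ?andbT// eq_sym.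
have eps0 : 0 <= eps by apply: le_trans (nuP _ aD).
move=> le2; apply: (le_trans le2); rewrite ler_wpM2r//.
by rewrite ler_weXn2l ?ler1n// max_card.
Qed.

End LinearForms.

Lemma weighted_forms_small (R : realType) (k : nat) (rho : R) : 0 < rho ->
  exists2 eps : R, 0 < eps <= 1 &
  forall (G : finFieldType) (nu : G -> R) (j : 'I_k) (s1 s2 : {set 'I_k})
    (a b : 'I_k -> {ffun 'I_k -> G} -> R),
  cube_forms k nu eps ->
  (forall i, i != j -> forall x, `|a i x| <= wt nu s1 i x) ->
  (forall i, i != j -> forall x, `|b i x| <= wt nu s2 i x) ->
  (forall i, i != j -> indep i (a i)) -> (forall i, i != j -> indep i (b i)) ->
  `|avg (fun z => (nu (psi j (mix finset.set0 z)) - 1) *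
        \prod_(i | i != j) (a i (mix finset.set0 z) * b i (mix [set j] z)))| <= rho.
Proof.
move=> rho0; set K : R := 2 ^+ #|{: 'I_k * {set 'I_k}}|.
have K0 : 0 < K by rewrite exprn_gt0.
pose m : R := 2 * (rho / 2) ^+ (2 ^ k.-1).
have m0 : 0 < m by rewrite mulr_gt0// exprn_gt0// divr_gt0.
exists (Num.min 1 (m / K)); first by rewrite lt_min ltr01 divr_gt0//= ge_min lexx.
move=> G nu j s1 s2 a b nuP aw bw ai bi; set M := avg _.
have := weighted_forms_bound nuP _ aw bw ai bi; rewrite ge_min lexx => /(_ isT).
rewrite -/M -/K leNgt => /negP MK; rewrite leNgt; apply/negP => rM; apply: MK.
apply: (@le_lt_trans _ _ m).
  by rewrite mulrC -ler_pdivlMr// ge_min lexx orbT.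
rewrite ltr_pM2l// ltrXn2r ?divr_ge0 ?ltW//; first by rewrite expn_eq0.
by rewrite ltr_pM2r.
Qed.

(** * Counting lemma *)

Section Counting.
Variables (R : realType) (k : nat) (G : finFieldType).
Notation X := {ffun 'I_k -> G}.
Implicit Types (i j : 'I_k) (x : X) (s : {set 'I_k}) (u v : X -> R).
Implicit Types (z : {ffun 'I_k * bool -> G}) (nu : G -> R).

Let G0 : (0 < #|G|)%N. Proof. by apply/card_gt0P; exists 0. Qed.
Let X0 : (0 < #|{: X}|)%N. Proof. by apply/card_gt0P; exists 0. Qed.

Lemma avg_double j (H : X -> X -> R) :
  avg (fun x => avg (fun t => H x (upd x j t)))
  = avg (fun z => H (mix finset.set0 z) (mix [set j] z)).
Proof.
pose L z := (mix finset.set0 z, z (j, true)).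
pose trZ (y : X * G) z : {ffun 'I_k * bool -> G} :=
  z + [ffun p => if p.2 then if p.1 == j then y.2 else 0 else y.1 p.1].
pose trY (y y' : X * G) := (y.1 + y'.1, y.2 + y'.2).
rewrite -(avg_pair (fun xt : X * G => H xt.1 (upd xt.1 j xt.2))).
rewrite -(avg_equidistributed (L := L) (trX := trZ) (trY := trY)).
- apply: eq_avg => z /=; congr (H _ _).
  by rewrite upd_mix finset.setU0.
- by apply/card_gt0P; exists 0.
- by move=> y; exact: addIr.
- by move=> y [a b] [a' b'] [/addIr -> /addIr ->].
- move=> z [y t]; congr (_, _).
    by apply/ffunP => i; rewrite !ffunE !inE addrC.
  by rewrite !ffunE/= eqxx addrC.
Qed.

Lemma avg_mix0 u : avg (fun z => u (mix finset.set0 z)) = avg u.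
Proof.
pose trZ (y : X) z : {ffun 'I_k * bool -> G} :=
  z + [ffun p => if p.2 then 0 else y p.1].
apply: (avg_equidistributed (trX := trZ) (trY := fun y y' => y + y')).
- by apply/card_gt0P; exists 0.
- by move=> y; exact: addIr.
- by move=> y a b /addIr.
- by move=> z y; apply/ffunP => i; rewrite !ffunE !inE addrC.
Qed.

(** A product of two averages over coordinate [j] is one average over two copies of it, the shape
    that [weighted_forms_small] treats. *)
Lemma avg_fiber_square j u v1 v2 : indep j u ->
  avg (fun x => u x * (fiber_avg j v1 x * fiber_avg j v2 x))
  = avg (fun z => u (mix finset.set0 z)
                  * (v1 (mix finset.set0 z) * v2 (mix [set j] z))).
Proof.
move=> uj; rewrite -(avg_double j (fun x y => u x * (v1 x * v2 y))).
have uv : indep j (fun x => u x * fiber_avg j v2 x).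
  by apply: indepM uj _; exact: indep_fiber_avg.
have := avg_fiberM G0 v1 uv => /= e1.
transitivity (avg (fun x => u x * fiber_avg j v2 x * v1 x)).
  by rewrite -e1; apply: eq_avg => x; rewrite -mulrA; congr (_ * _); rewrite mulrC.
by apply: eq_avg => x; rewrite mulrAC -avgZ; apply: eq_avg => t; rewrite mulrA.
Qed.

Definition others j (g : 'I_k -> X -> R) x := \prod_(i | i != j) g i x.

(* Smallness in the cut norm of the hypergraph system attached to the          *)
(* progression, with [-1, 1]-valued test functions instead of sets.            *)
Definition cut_small j (h : X -> R) (eta : R) :=
  forall u : 'I_k -> X -> R, (forall i, i != j -> indep i (u i)) ->
    (forall i x, `|u i x| <= 1) -> `|avg (fun x => h x * others j u x)| <= eta.

Variables (nu : G -> R) (eps : R).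
Hypothesis nuP : cube_forms k nu eps.

Lemma avg_nu_psi j : `|avg (fun x => nu (psi j x)) - 1| <= eps.
Proof.
have a1 : admissible [set (j, finset.set0)].
  by move=> u; rewrite !inE => /eqP ->; rewrite inE.
have := nuP a1.
by under eq_avg do rewrite big_set1; rewrite (avg_mix0 (fun x => nu (psi j x))).
Qed.

(** The first and second moments are averages over distinct cube forms, so both are within [eps] of
    1; expanding the square gives [eps + 2 * eps]. *)
Lemma fiber_others_variance j s :
  avg (fun x => (fiber_avg j (others j (wt nu s)) x - 1) ^+ 2) <= 3 * eps.
Proof.
set v := fiber_avg j _.
have adm (U : {set 'I_k}) : U \subset [set j] ->
    admissible (pairs (~: [set j]) (fun=> U) (fun=> s)).
  move=> /fintype.subsetP Uj u; rewrite !inE => /and3P[uj /fintype.subsetP us _].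
  by apply: contra uj => /us/Uj; rewrite inE.
have oneE : `|avg v - 1| <= eps.
  have := nuP (adm finset.set0 (finset.sub0set _)).
  rewrite -(eq_avg (F := fun z => others j (wt nu s) (mix finset.set0 z))).
    by rewrite avg_mix0 avg_fiber.
  move=> z; rewrite -(prod_pairs (cube_value nu ^~ z)).
  rewrite /others [RHS](eq_bigl (fun i => i != j)) => [|i]; last by rewrite !inE.
  by apply: eq_bigr => i _; rewrite powerset0 big_set1.
have twoE : `|avg (fun x => v x * v x) - 1| <= eps.
  have := nuP (adm _ (fintype.subxx _)).
  rewrite -(eq_avg (F := fun z => 1 * (others j (wt nu s) (mix finset.set0 z) *
      others j (wt nu s) (mix [set j] z)))).
    rewrite -(avg_fiber_square _ _ (u := fun=> 1))//.
    by under eq_avg do rewrite mul1r.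
  move=> z; rewrite -(prod_pairs (cube_value nu ^~ z)).
  rewrite mul1r /others -big_split/=.
  rewrite [RHS](eq_bigl (fun i => i != j)) => [|i]; last by rewrite !inE.
  apply: eq_bigr => i _; rewrite -[[set j] in RHS]finset.setU0.
  by rewrite prod_powersetU1 ?inE// powerset0 big_set1 finset.setU0.
rewrite (eq_avg (G := fun x => (v x * v x - 2 * v x) + 1)) => [|x]; last by ring.
rewrite avgD avgB avgZ avg_cst//.
move: (avg v) (avg (fun x => v x * v x)) oneE twoE => E1 E2.
rewrite !ler_norml; lra.
Qed.

End Counting.

(** * Making one factor dense *)

Section Densification.
Variables (R : realType) (k : nat) (G : finFieldType).
Notation X := {ffun 'I_k -> G}.
Variables (nu : G -> R) (eta sigma rho' rho'' : R) (s : {set 'I_k}) (j : 'I_k).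
Variables (g gt : 'I_k -> X -> R).
Hypothesis nuP : cube_forms k nu eta.
Hypothesis eta1 : eta <= 1.
Hypothesis eta_sigma : 3 * eta <= sigma ^+ 2.
Hypothesis sigma0 : 0 <= sigma.
Hypothesis js : j \in s.
Hypothesis g_indep : forall i, indep i (g i).
Hypothesis gt_indep : forall i, indep i (gt i).
Hypothesis g_bound : forall i x, 0 <= g i x <= wt nu s i x.
Hypothesis gt_bound : forall i x, 0 <= gt i x <= 1.
Hypothesis g_cut : cut_small j (fun x => g j x - gt j x) eta.

Let G0 : (0 < #|G|)%N. Proof. by apply/card_gt0P; exists 0. Qed.
Let X0 : (0 < #|{: X}|)%N. Proof. by apply/card_gt0P; exists 0. Qed.

(* Integrating out [x j] replaces the weight [nu (psi j x)] by [v'], which is  *)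
(* close to 1 in L2: in the dense model [g'] plays the role of [g j].          *)
Let g' := fiber_avg j (others j g).
Let t' := fiber_avg j (others j gt).
Let v' := fiber_avg j (others j (wt nu s)).
Let D x := g' x - t' x.
Let m x := Num.min (g' x) 1.

Let others_ge0 (h : 'I_k -> X -> R) x : (forall i x, 0 <= h i x) -> 0 <= others j h x.
Proof. by move=> h0; apply: prodr_ge0. Qed.

Let g'_ge0 x : 0 <= g' x.
Proof. by apply: avg_ge0 => t; apply: others_ge0 => i y; case/andP: (g_bound i y). Qed.

Let t'_ge0 x : 0 <= t' x.
Proof. by apply: avg_ge0 => t; apply: others_ge0 => i y; case/andP: (gt_bound i y). Qed.

Let g'_le x : g' x <= v' x.
Proof. by apply: le_avg => t; apply: ler_prod => i _. Qed.

Let t'_le1 x : t' x <= 1.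
Proof.
rewrite -(avg_cst 1 G0); apply: le_avg => t.
by apply: prodr_ile1 => i _.
Qed.

(** The integrand vanishes where [g' <= 1]. Elsewhere [g' - m <= v' - 1] and [D <= v'], so the L1
    and L2 norms of [v' - 1] control it. *)
Lemma truncation_error : avg (fun x => D x * (g' x - m x)) <= sigma ^+ 2 + 2 * sigma.
Proof.
set w := fun x => `|v' x - 1|.
have Dw x : D x * (g' x - m x) <= w x ^+ 2 + 2 * w x.
  have := g'_ge0 x; have := g'_le x; have := t'_ge0 x; have := t'_le1 x.
  rewrite /w /D /m; move: (g' x) (t' x) (v' x) => a b c b1 b0 ac a0.
  have [a1|a1] := leP a 1.
    by rewrite subrr mulr0 addr_ge0 ?mulr_ge0 ?sqr_ge0.
  rewrite (ger0_norm (_ : 0 <= c - 1)); last lra.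
  nra.
have vw := fiber_others_variance nuP j s.
have W2 : avg (fun x => w x ^+ 2) <= sigma ^+ 2.
  apply: le_trans eta_sigma; apply: le_trans vw.
  by apply: le_avg => x; rewrite real_normK ?num_real.
have W1 : avg w <= sigma.
  have w0 x : 0 <= w x by exact: normr_ge0.
  rewrite -(ler_pXn2r (n := 2)) ?nnegrE ?avg_ge0//.
  apply: le_trans (avg_norm_CS _ X0) _.
  by apply: le_trans eta_sigma; exact: vw.
apply: (@le_trans _ _ (avg (fun x => w x ^+ 2 + 2 * w x))); first exact: le_avg.
rewrite avgD avgZ; lra.
Qed.

(** In [counting_lemma] this is the induction hypothesis, as [h] in place of [g j] leaves one sparse
    index fewer; the next hypothesis is [weighted_forms_small]. *)
Hypothesis dense_count : forall h : X -> R, indep j h -> (forall x, 0 <= h x <= 1) ->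
  `|avg (fun x => h x * others j g x) - avg (fun x => h x * others j gt x)| <= rho'.
Hypothesis weighted_small : forall s1 s2 (a b : 'I_k -> X -> R),
  (forall i, i != j -> forall x, `|a i x| <= wt nu s1 i x) ->
  (forall i, i != j -> forall x, `|b i x| <= wt nu s2 i x) ->
  (forall i, i != j -> indep i (a i)) -> (forall i, i != j -> indep i (b i)) ->
  `|avg (fun z => (nu (psi j (mix finset.set0 z)) - 1) *
        \prod_(i | i != j) (a i (mix finset.set0 z) * b i (mix [set j] z)))| <= rho''.

Let D_count h : indep j h -> (forall x, 0 <= h x <= 1) ->
  `|avg (fun x => D x * h x)| <= rho'.
Proof.
move=> hj h01; rewrite (_ : avg _ = avg (fun x => h x * others j g x)
  - avg (fun x => h x * others j gt x)); first exact: dense_count.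
rewrite -(avg_fiberM G0 _ hj) -(avg_fiberM G0 (others j gt) hj) -avgB.
by apply: eq_avg => x; rewrite -mulrBr mulrC.
Qed.

(** One factor [D] is written as [m - t' + (g' - m)]. Both [m] and [t'] ignore [x j] and take values
    in [0, 1], so [dense_count] applies to them. *)
Lemma densified_L2 : avg (fun x => D x ^+ 2) <= 2 * rho' + (sigma ^+ 2 + 2 * sigma).
Proof.
rewrite (eq_avg (G := fun x =>
  (D x * m x - D x * t' x) + D x * (g' x - m x))); last first.
  by move=> x; rewrite /D; ring.
rewrite avgD lerD ?truncation_error// avgB.
have m_indep : indep j m by move=> x t; rewrite /m /g' indep_fiber_avg.
have := D_count m_indep; have := D_count (@indep_fiber_avg _ _ _ j (others j gt)).
rewrite -/t' => H1 H2.
have {}H1 : `|avg (fun x => D x * t' x)| <= rho'.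
  by apply: H1 => x; rewrite t'_ge0 t'_le1.
have {}H2 : `|avg (fun x => D x * m x)| <= rho'.
  by apply: H2 => x; rewrite /m le_min g'_ge0 ler01 ge_min lexx orbT.
move: (avg _) (avg (fun x => D x * t' x)) H1 H2 => E1 E2.
by rewrite !ler_norml; lra.
Qed.

(** Expanding [(nu - 1) * D ^+ 2] gives four averages with two fibre averages each;
    [avg_fiber_square] makes each an instance of [weighted_small]. *)
Lemma weighted_L2 : avg (fun x => nu (psi j x) * D x ^+ 2)
  <= 4 * rho'' + (2 * rho' + (sigma ^+ 2 + 2 * sigma)).
Proof.
pose N x := nu (psi j x) - 1.
have Nj : indep j N by move=> x t; rewrite /N psi_indep.
rewrite (eq_avg (G := fun x => (N x * (g' x * g' x) - N x * (g' x * t' x)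
   - N x * (t' x * g' x) + N x * (t' x * t' x)) + D x ^+ 2)); last first.
  by move=> x; rewrite /N /D; ring.
rewrite avgD lerD ?densified_L2// avgD !avgB /g' /t' !avg_fiber_square//.
have gb i x : `|g i x| <= wt nu s i x.
  by case/andP: (g_bound i x) => a b; rewrite ger0_norm.
have tb i x : `|gt i x| <= wt nu finset.set0 i x.
  by rewrite /wt inE; case/andP: (gt_bound i x) => a b; rewrite ger0_norm.
have E s1 s2 a b : (forall i x, `|a i x| <= wt nu s1 i x) ->
   (forall i x, `|b i x| <= wt nu s2 i x) ->
   (forall i, indep i (a i)) -> (forall i, indep i (b i)) ->
   `|avg (fun z => N (mix finset.set0 z) *
      (others j a (mix finset.set0 z) * others j b (mix [set j] z)))| <= rho''.
  move=> aw bw ai bi; have := @weighted_small s1 s2 a b.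
  under eq_avg do rewrite big_split/=; apply; by move=> *; auto.
have := E _ _ _ _ gb gb g_indep g_indep; have := E _ _ _ _ gb tb g_indep gt_indep.
have := E _ _ _ _ tb gb gt_indep g_indep; have := E _ _ _ _ tb tb gt_indep gt_indep.
move: (avg _) (avg _) (avg _) (avg _) => E1 E2 E3 E4.
rewrite !ler_norml; lra.
Qed.

(** The difference splits into [g j - gt j] against bounded factors, controlled by the cut norm, and
    [g j * D], controlled by Cauchy-Schwarz with weight [g j <= nu (psi j)]. *)
Lemma densification :
  `|avg (fun x => g j x * others j g x) - avg (fun x => gt j x * others j gt x)|
  <= eta + Num.sqrt (2 * (4 * rho'' + (2 * rho' + (sigma ^+ 2 + 2 * sigma)))).
Proof.
have -> : avg (fun x => g j x * others j g x) - avg (fun x => gt j x * others j gt x)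
    = avg (fun x => (g j x - gt j x) * others j gt x) + avg (fun x => g j x * D x).
  have -> : avg (fun x => g j x * D x) = avg (fun x => g j x * others j g x)
       - avg (fun x => g j x * others j gt x).
    rewrite -(avg_fiberM G0 (others j g) (g_indep j)).
    rewrite -(avg_fiberM G0 (others j gt) (g_indep j)) -avgB.
    by apply: eq_avg => x; rewrite mulrBr.
  rewrite -!avgB -avgD; apply: eq_avg => x; ring.
apply: le_trans (ler_normD _ _) _; apply: lerD.
  apply: g_cut => i; first by move=> _; exact: gt_indep.
  by move=> x; case/andP: (gt_bound i x) => a b; rewrite ger0_norm.
rewrite -sqrtr_sqr ler_wsqrtr//.
apply: le_trans (avg_CS _ _) _; first by move=> x; case/andP: (g_bound j x).
have gnu x : g j x <= nu (psi j x).
  by case/andP: (g_bound j x) => _; rewrite /wt js.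
apply: (@le_trans _ _ (2 * avg (fun x => g j x * D x ^+ 2))).
  rewrite ler_wpM2r//.
    by apply: avg_ge0 => x; rewrite mulr_ge0 ?sqr_ge0//; case/andP: (g_bound j x).
  apply: (@le_trans _ _ (avg (fun x => nu (psi j x)))); first exact: le_avg.
  by have := avg_nu_psi nuP j; rewrite ler_norml; have := eta1; lra.
rewrite ler_pM2l//; apply: le_trans weighted_L2.
by apply: le_avg => x; rewrite ler_wpM2r ?sqr_ge0.
Qed.

End Densification.

(* Induction on the number of indices where the weight is still [nu]: each     *)
(* step makes one of them dense.                                               *)
Lemma counting_lemma (R : realType) (k n : nat) (rho : R) : 0 < rho ->
  exists2 eta : R, 0 < eta &
  forall (G : finFieldType) (nu : G -> R) (s : {set 'I_k})
    (g gt : 'I_k -> {ffun 'I_k -> G} -> R),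
  (#|s| <= n)%N -> cube_forms k nu eta ->
  (forall i, indep i (g i)) -> (forall i, indep i (gt i)) ->
  (forall i x, 0 <= g i x <= wt nu s i x) -> (forall i x, 0 <= gt i x <= 1) ->
  (forall i, i \in s -> cut_small i (fun x => g i x - gt i x) eta) ->
  (forall i x, i \notin s -> g i x = gt i x) ->
  `|avg (fun x => \prod_i g i x) - avg (fun x => \prod_i gt i x)| <= rho.
Proof.
elim: n rho => [|n IHn] rho rho0.
  exists 1 => // G nu s g gt; rewrite leqn0 cards_eq0 => /eqP -> _ _ _ _ _ _ ggt.
  rewrite (eq_avg (G := fun x => \prod_i gt i x)) ?subrr ?normr0 ?ltW// => x.
  by apply: eq_bigr => i _; rewrite ggt ?inE.
(* With [sigma = rho' = rho'' = d <= 1] the radicand in [densification] is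
   [16 d + 2 d^2 <= 20 d]. *)
pose d := Num.min 1 ((rho / 2) ^+ 2 / 20).
have d0 : 0 < d by rewrite lt_min ltr01 divr_gt0// exprn_gt0// divr_gt0.
have dle : 20 * d <= (rho / 2) ^+ 2.
  by rewrite mulrC -ler_pdivlMr// ge_min lexx orbT.
have d1 : d <= 1 by rewrite ge_min lexx.
have [eta1 eta1_gt0 IH] := IHn d d0.
have [eta2 /andP[eta2_gt0 eta2_le1] WF] := weighted_forms_small k d0.
pose eta := Num.min (Num.min eta1 eta2) (Num.min (rho / 2) (d ^+ 2 / 3)).
have eta_gt0 : 0 < eta.
  by rewrite !lt_min eta1_gt0 eta2_gt0/= !divr_gt0// exprn_gt0.
have eta_le : [/\ eta <= eta1, eta <= eta2, eta <= rho / 2 & eta <= d ^+ 2 / 3].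
  by split; rewrite !ge_min lexx ?orbT.
case: eta_le => eta_le1 eta_le2 eta_le3 eta_le4.
exists eta => // G nu s g gt sn nuP gi gti gb gtb gcut ggt.
have [s0|[j js]] := set_0Vmem s.
  rewrite (eq_avg (G := fun x => \prod_i gt i x)) ?subrr ?normr0 ?ltW// => x.
  by apply: eq_bigr => i _; rewrite ggt// s0 inE.
have nuPle e : eta <= e -> cube_forms k nu e.
  by move=> ee U aU; apply: le_trans (nuP U aU) ee.
have prodE (h : 'I_k -> {ffun 'I_k -> G} -> R) :
    avg (fun x => \prod_i h i x) = avg (fun x => h j x * others j h x).
  by apply: eq_avg => x; rewrite (bigD1 j).
have dense h : indep j h -> (forall x, 0 <= h x <= 1) ->
  `|avg (fun x => h x * others j g x) - avg (fun x => h x * others j gt x)| <= d.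
  move=> hj h01.
  pose put (f : 'I_k -> {ffun 'I_k -> G} -> R) i := if i == j then h else f i.
  have putE f : avg (fun x => h x * others j f x) = avg (fun x => \prod_i put f i x).
    rewrite prodE; apply: eq_avg => x; rewrite /put eqxx; congr (_ * _).
    by apply: eq_bigr => i /negPf ->.
  rewrite !putE; apply: (IH G nu (s :\ j)) => //.
  - by move: sn; rewrite (cardsD1 j) js.
  - exact: nuPle.
  - by move=> i; rewrite /put; case: eqP => [->|].
  - by move=> i; rewrite /put; case: eqP => [->|].
  - move=> i x; rewrite /put /wt !inE; case: eqP => //= _; exact: gb.
  - by move=> i x; rewrite /put; case: eqP.
  - move=> i; rewrite /put !inE; case: eqP => //= _ /gcut gc u ui u1.
    by apply: le_trans (gc u ui u1) _.
  - by move=> i x; rewrite /put !inE; case: eqP => //= _ /ggt.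
rewrite !prodE.
apply: le_trans (@densification R k G nu eta d d d s j g gt
  _ _ _ _ _ _ _ _ _ _ _ _) _ => //.
- by apply: le_trans eta_le2 _.
- by move: eta_le4; rewrite ler_pdivlMr// mulrC.
- exact: ltW.
- exact: gcut.
- by move=> s1 s2 a b; apply: WF; exact: nuPle.
rewrite (_ : rho = rho / 2 + rho / 2); last by field.
have rho2 : 0 <= rho / 2 by rewrite divr_ge0 ?ltW.
apply: lerD => //; rewrite -[leRHS](ger0_norm rho2) -sqrtr_sqr.
rewrite ler_wsqrtr//; nra.
Qed.

(** * Dense model theorem *)

Section PositivePart.
Variable R : realType.

(** The iteration [q + (t^2 - q^2) / 2] increases to [|t|]: an error [e] becomes at most
    [e - e^2 / 2], which takes [2 / (n + 2)] below [2 / (n + 3)]. *)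
Lemma abs_poly_approx n : exists q : {poly R}, forall t, `|t| <= 1 ->
  0 <= q.[t] <= `|t| /\ `|t| <= q.[t] + 2 / (n%:R + 2).
Proof.
elim: n => [|n [q IH]].
  by exists 0 => t t1; rewrite horner0 lexx normr_ge0 !add0r divff.
exists (q + 2^-1 *: ('X^2 - q ^+ 2)) => t t1.
have -> : (q + 2^-1 *: ('X^2 - q ^+ 2)).[t] = q.[t] + (`|t| ^+ 2 - q.[t] ^+ 2) / 2.
  by rewrite !hornerE real_normK ?num_real//; ring.
have [/andP[]] := IH t t1.
have n0 : 0 <= n%:R :> R by [].
have -> : n.+1%:R = n%:R + 1 :> R by rewrite natr1.
move: (`|t|) q.[t] t1 (n%:R) n0 (normr_ge0 t) => a b a1 m m0 a0 b0 ba.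
have up : 0 <= (a - b) * (a + b) by rewrite mulr_ge0//; lra.
have down : 0 <= (a - b) * (2 - (a + b)) by rewrite mulr_ge0//; lra.
set e := 2 / (m + 2) => ae; split; first by apply/andP; split; lra.
have e1 : e <= 1 by rewrite ler_pdivrMr; lra.
have e0 : 0 <= e by rewrite divr_ge0; lra.
have : a - b <= e by lra.
have : e - e ^+ 2 / 2 <= 2 / (m + 1 + 2).
  rewrite -subr_ge0 (_ : _ - _ = 2 / ((m + 3) * (m + 2) ^+ 2)).
    by rewrite divr_ge0// mulr_ge0 ?sqr_ge0//; lra.
  by rewrite /e; field; do ?[apply/andP; split]; apply: lt0r_neq0; lra.
set e' := 2 / _ => ee'.
have mon : 0 <= (e - (a - b)) * (2 - (e + (a - b))) by rewrite mulr_ge0//; lra.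
have sq : 0 <= (a - b) * b by rewrite mulr_ge0//; lra.
lra.
Qed.

(** The positive part is [(t + |t|) / 2], rescaled from [-M, M] to [-1, 1]. *)
Lemma pos_part_poly_approx (M eps : R) : 0 < M -> 0 < eps ->
  exists p : {poly R}, forall t, `|t| <= M ->
    p.[t] - eps <= Num.max t 0 <= p.[t] + eps.
Proof.
move=> M0 eps0; have [q qP] := abs_poly_approx (Num.truncn (M / eps)).
exists (2^-1 *: ('X + M *: (q \Po (M^-1 *: 'X)))) => t tM.
rewrite !hornerE horner_comp !hornerE.
have tM1 : `|M^-1 * t| <= 1.
  by rewrite normrM gtr0_norm ?invr_gt0// ler_pdivrMl// mulr1.
have [/andP[b0 ba] ae] := qP _ tM1.
have tE : `|t| = M * `|M^-1 * t|.
  by rewrite normrM gtr0_norm ?invr_gt0// mulrA divff ?mul1r// gt_eqF.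
have : M * `|M^-1 * t| - M * q.[M^-1 * t] <= 2 * eps.
  rewrite -mulrBr; apply: (@le_trans _ _ (M * (2 / ((Num.truncn (M / eps))%:R + 2)))).
    by rewrite ler_pM2l// lerBlDl.
  rewrite mulrA ler_pdivrMr ?ltr_wpDl// mulrC -mulrA ler_pM2l//.
  rewrite -ler_pdivrMl// mulrC; apply/ltW.
  apply: lt_trans (truncnS_gt _) _.
  by rewrite -natr1; lra.
have : M * q.[M^-1 * t] <= M * `|M^-1 * t| by rewrite ler_pM2l.
rewrite -tE; have [t0|t0] := leP t 0.
  by rewrite ler0_norm//; lra.
by rewrite gtr0_norm//; lra.
Qed.

End PositivePart.

Section DenseModel.
Variable R : realType.

Let clip (t : R) := if t <= 0 then 0 else if t <= 1 then t else 1.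
Let Psi (t : R) := if t <= 0 then 0 else if t <= 1 then t ^+ 2 / 2 else t - 1 / 2.

Let clip01 t : 0 <= clip t <= 1.
Proof.
by rewrite /clip; case: (leP t 0) => a; [|case: (leP t 1) => b]; apply/andP; split; lra.
Qed.

(* [Psi] is a primitive of the 1-Lipschitz function [clip].                    *)
Let Psi_smooth t d : Psi (t + d) <= Psi t + clip t * d + d ^+ 2 / 2.
Proof.
rewrite /Psi /clip; case: (leP t 0) => t0; case: (leP (t + d) 0) => d0;
  case: (leP (t + d) 1) => d1; try case: (leP t 1) => t1; nra.
Qed.

Let Psi_ge t : Num.max t 0 - 1 / 2 <= Psi t.
Proof.
rewrite /Psi; case: (leP t 0) => t0; first by lra.
by case: (leP t 1) => t1; nra.
Qed.

(* Projected gradient descent: if [clip \o h] is not yet a model, some test    *)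
(* function [phi] detects it, and replacing [h] by [h + eps * phi] increases   *)
(* [avg (f * h) - avg (Psi \o h)] by at least [eps ^+ 2 / 2]. This quantity is *)
(* bounded, because [f * h <= nu * h^+] and [nu] cannot be distinguished from  *)
(* 1 by a polynomial in [h] approximating [h^+].                               *)
Lemma dense_model (eps : R) : 0 < eps -> exists2 eta : R, 0 < eta &
  forall (X : finType) (nu f : X -> R) (Fam Pr : (X -> R) -> Prop),
  (0 < #|X|)%N -> (forall x, 0 <= f x <= nu x) ->
  Fam (fun=> 1) -> (forall phi, Fam phi -> Fam (fun x => - phi x)) ->
  (forall phi x, Fam phi -> `|phi x| <= 1) ->
  Pr (fun=> 1) ->
  (forall phi g, Fam phi -> Pr g -> Pr (fun x => phi x * g x)) ->
  (forall g, Pr g -> `|avg (fun x => (nu x - 1) * g x)| <= eta) ->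
  exists2 ft : X -> R, (forall x, 0 <= ft x <= 1) &
    forall phi, Fam phi -> `|avg (fun x => (f x - ft x) * phi x)| <= eps.
Proof.
(* After [n] steps the total gain exceeds 1, the bound reached at the end of the proof. *)
move=> eps0; pose n := (Num.truncn (2 / eps ^+ 2)).+1.
have n_big : 1 < n%:R * (eps ^+ 2 / 2).
  have := truncnS_gt (2 / eps ^+ 2); rewrite -/n ltr_pdivrMr ?exprn_gt0//.
  by rewrite mulrA ltr_pdivlMr// mul1r.
pose M : R := n%:R * eps.
have M0 : 0 < M by rewrite mulr_gt0// ltr0n.
have e8 : 0 < 1 / 8 :> R by lra.
have [p pP] := pos_part_poly_approx M0 e8.
pose S : R := \sum_(d < size p) `|p`_d| * M ^+ d.
have S0 : 0 <= S.
  by apply: sumr_ge0 => d _; rewrite mulr_ge0// exprn_ge0// ltW.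
(* The bound 1 on the gain is 1/2 from [Psi_ge], 1/4 from the polynomial approximation, and
   [(S + 1) * eta = 1/4] from replacing [nu] by 1. *)
pose eta : R := 1 / (4 * (S + 1)).
have eta0 : 0 < eta by rewrite divr_gt0// mulr_gt0//; lra.
have etaS : (S + 1) * eta = 1 / 4 by rewrite /eta; field; apply: lt0r_neq0; lra.
exists eta => // X nu f Fam Pr X0 fnu Fam1 FamN Fam_le1 Pr1 PrM nuPr.
apply: contrapT => no_ft.
have pick (ft : X -> R) : (forall x, 0 <= ft x <= 1) ->
    exists2 phi, Fam phi & eps < avg (fun x => (f x - ft x) * phi x).
  move=> ft01; apply: contrapT => no_phi; apply: no_ft; exists ft => // phi Fphi.
  have le phi' : Fam phi' -> avg (fun x => (f x - ft x) * phi' x) <= eps.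
    by move=> Fphi'; rewrite leNgt; apply/negP => lt; apply: no_phi; exists phi'.
  rewrite ler_norml le// andbT.
  have := le _ (FamN _ Fphi).
  rewrite (eq_avg (G := fun x => -1 * ((f x - ft x) * phi x))).
    by rewrite avgZ mulN1r lerNl.
  by move=> x; ring.
pose step (phi : nat -> X -> R) m x := eps * \sum_(i < m) phi i x.
have [phi Fphi gain] : exists2 phi : nat -> X -> R, forall i, Fam (phi i) &
   n%:R * (eps ^+ 2 / 2)
   <= avg (fun x => f x * step phi n x) - avg (fun x => Psi (step phi n x)).
  elim: (n) => [|m [phi Fphi IH]].
    exists (fun _ _ => 1) => //.
    rewrite -avgB mul0r (eq_avg (G := fun=> 0)) ?avg_cst// => x.
    by rewrite /step big_ord0 mulr0 /Psi lexx mulr0 subrr.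
  set h := step phi m in IH.
  have [phi' Fphi' gt_eps] := pick (clip \o h) (fun x => clip01 (h x)).
  exists (fun i => if i == m then phi' else phi i).
    by move=> i; case: eqP.
  set h' := step _ _; have h'E x : h' x = h x + eps * phi' x.
    rewrite /h' /h /step big_ord_recr/= eqxx mulrDr; congr (_ * _ + _).
    by apply: eq_bigr => i _; rewrite ltn_eqF.
  have : avg (fun x => Psi (h' x)) <= avg (fun x => Psi (h x)) +
     eps * avg (fun x => clip (h x) * phi' x) + eps ^+ 2 / 2.
    rewrite -avgZ -(avg_cst (eps ^+ 2 / 2) X0) -!avgD; apply: le_avg => x.
    rewrite h'E; apply: le_trans (Psi_smooth _ _) _.
    rewrite [clip (h x) * (eps * _)]mulrCA lerD2l ler_pM2r ?invr_gt0//.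
    rewrite exprMn ler_piMr ?sqr_ge0//.
    rewrite -[_ ^+ 2]real_normK ?num_real//.
    by rewrite exprn_ile1// Fam_le1.
  have -> : avg (fun x => f x * h' x) = avg (fun x => f x * h x)
      + eps * avg (fun x => f x * phi' x).
    by rewrite -avgZ -avgD; apply: eq_avg => x; rewrite h'E; ring.
  have : avg (fun x => (f x - (clip \o h) x) * phi' x)
      = avg (fun x => f x * phi' x) - avg (fun x => clip (h x) * phi' x).
    by rewrite -avgB; apply: eq_avg => x; rewrite mulrBl.
  move=> E; rewrite E in gt_eps; move: IH gt_eps.
  have -> : m.+1%:R = m%:R + 1 :> R by rewrite natr1.
  move: (avg (fun x => f x * phi' x)) (avg (fun x => clip (h x) * phi' x)).
  move: (avg _) (avg _) (avg _) (m%:R) => A1 A2 A3 mm A4 A5 IH gt_eps le_Psi.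
  have : eps * eps <= eps * (A4 - A5) by rewrite ler_pM2l// ltW.
  lra.
set h := step phi n in gain.
have hM x : `|h x| <= M.
  rewrite /h /step normrM (gtr0_norm eps0) /M mulrC ler_pM2r//.
  apply: le_trans (ler_norm_sum _ _ _) _.
  apply: (@le_trans _ _ (\sum_(i < n) 1)); last by rewrite sumr_const card_ord.
  by apply: ler_sum => i _; exact: Fam_le1.
(* Powers of [h] expand into products of the [phi i]; [g] collects the factors already split off. *)
have hpow d : forall g, Pr g ->
    `|avg (fun x => (nu x - 1) * (g x * h x ^+ d))| <= M ^+ d * eta.
  elim: d => [|d IHd] g Pg.
    rewrite mul1r; under eq_avg do rewrite expr0 mulr1; exact: nuPr.
  have -> : avg (fun x => (nu x - 1) * (g x * h x ^+ d.+1)) = eps *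
      \sum_(i < n) avg (fun x => (nu x - 1) * ((phi i x * g x) * h x ^+ d)).
    rewrite -avg_sum -avgZ; apply: eq_avg => x; rewrite exprS {1}/h /step.
    by rewrite -!mulr_sumr -!mulr_suml; ring.
  rewrite normrM (gtr0_norm eps0).
  have -> : M ^+ d.+1 * eta = eps * (n%:R * (M ^+ d * eta)).
    by rewrite exprS {1}/M; ring.
  rewrite ler_pM2l//; apply: le_trans (ler_norm_sum _ _ _) _.
  apply: (@le_trans _ _ (\sum_(i < n) M ^+ d * eta)).
    by apply: ler_sum => i _; apply: IHd; exact: PrM.
  by rewrite sumr_const card_ord mulr_natl.
have hp : `|avg (fun x => (nu x - 1) * p.[h x])| <= S * eta.
  have -> : avg (fun x => (nu x - 1) * p.[h x])
      = \sum_(d < size p) p`_d * avg (fun x => (nu x - 1) * (1 * h x ^+ d)).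
    rewrite (eq_bigr _ (fun d _ => esym (avgZ _ _))) -avg_sum.
    apply: eq_avg => x; rewrite horner_coef mulr_sumr.
    by apply: eq_bigr => d _; ring.
  apply: le_trans (ler_norm_sum _ _ _) _; rewrite mulr_suml.
  apply: ler_sum => d _; rewrite normrM -mulrA ler_wpM2l//; exact: hpow.
have nu1 : `|avg (fun x => (nu x - 1) * 1)| <= eta by exact: nuPr.
have f_le : avg (fun x => f x * h x)
    <= avg (fun x => (nu x - 1) * p.[h x] + (1 / 8) * ((nu x - 1) * 1))
       + avg (fun x => Num.max (h x) 0) + 1 / 4.
  rewrite -(avg_cst (1 / 4) X0) -!avgD; apply: le_avg => x.
  have /andP[lo hi] := pP _ (hM x); have /andP[f0 fn] := fnu x.
  apply: (@le_trans _ _ (f x * Num.max (h x) 0)).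
    by rewrite ler_wpM2l// le_max lexx.
  apply: (@le_trans _ _ (nu x * Num.max (h x) 0)).
    by rewrite ler_wpM2r// le_max lexx orbT.
  have nu0 : 0 <= nu x by exact: le_trans fn.
  have : 0 <= nu x * (p.[h x] + 1 / 8 - Num.max (h x) 0) by rewrite mulr_ge0// subr_ge0.
  lra.
have P_ge : avg (fun x => Num.max (h x) 0) - 1 / 2 <= avg (fun x => Psi (h x)).
  by rewrite -[X in _ - X](avg_cst (1 / 2) X0) -avgB; apply: le_avg.
move: f_le; rewrite avgD avgZ => f_le.
move: gain P_ge f_le hp nu1; rewrite !ler_norml.
move: (avg (fun x => Psi (h x))) (avg (fun x => f x * h x)) (avg _) => A1 A2 A3.
move: (avg _) (avg _) => A4 A5; lra.
Qed.

End DenseModel.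

(** * Test functions *)

Section TestFunctions.
Variables (R : realType) (k : nat) (G : finFieldType) (j0 i1 : 'I_k).
Notation X := {ffun 'I_k -> G}.
Implicit Types (i j : 'I_k) (x h : X) (u v : 'I_k -> X -> R) (c d : R).
Hypothesis coef_neq0 : forall i j, i != j -> i%:R - j%:R != 0 :> G.
Hypothesis i1j0 : i1 != j0.

Let G0 : (0 < #|G|)%N. Proof. by apply/card_gt0P; exists 0. Qed.
Let X0 : (0 < #|{: X}|)%N. Proof. by apply/card_gt0P; exists 0. Qed.

Lemma psiD j x h : psi j (x + h) = psi j x + psi j h.
Proof. by rewrite -big_split; apply: eq_bigr => i _; rewrite ffunE mulrDr. Qed.

(** A linear section of [psi j0] supported on coordinate [i1], used to move points between
    fibres. *)
Definition lift_psi (t : G) : X :=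
  [ffun i => if i == i1 then t / (i1%:R - j0%:R) else 0].

Lemma lift_psiB t t' : lift_psi (t - t') = lift_psi t - lift_psi t'.
Proof. by apply/ffunP => i; rewrite !ffunE; case: eqP; rewrite ?mulrBl ?subr0. Qed.

Lemma psi_lift t : psi j0 (lift_psi t) = t.
Proof.
rewrite /psi (bigD1 i1)//= ffunE eqxx big1 ?addr0 => [|i /negPf ii1].
  by rewrite mulrC divfK// coef_neq0.
by rewrite ffunE ii1 mulr0.
Qed.

Lemma avg_translate h (F : X -> R) : avg (fun x => F (x + h)) = avg F.
Proof. by rewrite [RHS](avg_reindex _ (h := fun x => x + h))//; apply/injF_bij/addIr. Qed.

Lemma indep_translate i h (F : X -> R) : indep i F -> indep i (fun x => F (x + h)).
Proof.
move=> Fi x t; rewrite -(Fi (x + h) (t + h i)); congr F.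
by apply/ffunP => l; rewrite !ffunE; case: eqP => // ->.
Qed.

(* [test c u y] is the average of [c * others j0 u] over the fiber             *)
(* [psi j0 x = y].                                                             *)
Definition test c u (y : G) : R :=
  c * avg (fun x => others j0 u (x + lift_psi (y - psi j0 x))).

Definition is_test (phi : G -> R) := exists c u,
  [/\ `|c| <= 1, forall i, i != j0 -> indep i (u i), forall i x, `|u i x| <= 1
    & forall y, phi y = test c u y].

Lemma avg_test (F : G -> R) c u :
  avg (fun y => F y * test c u y)
  = c * avg (fun x => F (psi j0 x) * others j0 u x).
Proof.
pose H x := F (psi j0 x) * others j0 u x.
transitivity (c * avg (fun y => avg (fun x => H (x + lift_psi (y - psi j0 x))))).
  rewrite -avgZ; apply: eq_avg => y; rewrite /test mulrCA; congr (_ * _).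
  rewrite -avgZ; apply: eq_avg => x; rewrite /H psiD psi_lift; congr (F _ * _).
  by rewrite addrC subrK.
congr (_ * _); rewrite avg_exchange.
transitivity (avg (fun x => avg (fun t => H (x + lift_psi t)))).
  apply: eq_avg => x.
  rewrite [RHS](avg_reindex _ (h := fun y => y - psi j0 x))//.
  exact/injF_bij/addIr.
rewrite avg_exchange -[RHS](avg_cst _ G0); apply: eq_avg => t.
exact: avg_translate.
Qed.

Lemma others_le1 j u x : (forall i y, `|u i y| <= 1) -> `|others j u x| <= 1.
Proof.
move=> u1; rewrite normr_prod; apply: prodr_ile1 => i _.
by rewrite normr_ge0 u1.
Qed.

Lemma test_le1 phi y : is_test phi -> `|phi y| <= 1.
Proof.
move=> [c [u [c1 _ u1 ->]]]; rewrite normrM; apply: mulr_ile1 => //.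
by apply: avg_norm_le => // x; exact: others_le1.
Qed.

Lemma is_test1 : is_test (fun=> 1).
Proof.
exists 1, (fun _ _ => 1); split => //; rewrite ?normr1// => y.
rewrite /test mul1r -[LHS](avg_cst 1 X0).
by apply: eq_avg => x; rewrite /others big1.
Qed.

Lemma is_testN phi : is_test phi -> is_test (fun y => - phi y).
Proof.
move=> [c [u [c1 ui u1 E]]]; exists (- c), u; split; rewrite ?normrN// => y.
by rewrite E /test mulNr.
Qed.

(** The second point of the fibre is the first plus [h - lift_psi (psi j0 h)], an element of the
    kernel of [psi j0]. For fixed [h] both families of factors are evaluated at one point and
    multiply into a single family. *)
Lemma is_test_mul phi psi' : is_test phi -> is_test psi' ->
  exists2 w : X -> G -> R, forall h, is_test (w h) &
    forall y, phi y * psi' y = avg (fun h => w h y).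
Proof.
move=> [c [u [c1 ui u1 Eu]]] [d [v [d1 vi v1 Ev]]].
pose w h i x := u i x * v i (x + (h - lift_psi (psi j0 h))).
exists (fun h => test (c * d) (w h)) => [h|y].
  exists (c * d), (w h); split=> // [|i ij|i x].
  - by rewrite normrM mulr_ile1.
  - by apply: indepM; [exact: ui|apply: indep_translate; exact: vi].
  - by rewrite normrM mulr_ile1.
rewrite Eu Ev /test mulrACA avgZ; congr (_ * _); rewrite avg_mul.
transitivity (avg (fun x => avg (fun h =>
    others j0 u (x + lift_psi (y - psi j0 x))
    * others j0 v (h + x + lift_psi (y - psi j0 (h + x)))))).
  apply: eq_avg => x.
  by rewrite -(avg_translate x).
rewrite avg_exchange; apply: eq_avg => x; apply: eq_avg => h.
rewrite /others -big_split; apply: eq_bigr => i _; congr (_ * v i _).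
have -> : y - psi j0 (h + x) = (y - psi j0 x) - psi j0 h.
  by rewrite psiD opprD addrCA addrC.
by rewrite lift_psiB [h + x]addrC addrACA.
Qed.

Lemma test_nu_small (nu : G -> R) (rho : R) : 
  (forall (s1 s2 : {set 'I_k}) (a b : 'I_k -> X -> R),
    (forall i, i != j0 -> forall x, `|a i x| <= wt nu s1 i x) ->
    (forall i, i != j0 -> forall x, `|b i x| <= wt nu s2 i x) ->
    (forall i, i != j0 -> indep i (a i)) -> (forall i, i != j0 -> indep i (b i)) ->
    `|avg (fun z => (nu (psi j0 (mix finset.set0 z)) - 1) *
        \prod_(i | i != j0) (a i (mix finset.set0 z) * b i (mix [set j0] z)))| <= rho) ->
  forall phi, is_test phi -> `|avg (fun y => (nu y - 1) * phi y)| <= rho.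
Proof.
move=> small phi [c [u [c1 ui u1 E]]].
under eq_avg do rewrite E.
rewrite avg_test normrM -(avg_mix0 (fun x => (nu (psi j0 x) - 1) * others j0 u x)).
apply: le_trans (ler_piMl (normr_ge0 _) c1) _.
have := small finset.set0 finset.set0 u (fun _ _ => 1).
rewrite /wt; under eq_avg do under eq_bigr do rewrite mulr1.
by apply => // i _ x; rewrite inE ?normr1.
Qed.

(* The linear change of variables [T] carries [psi j0] to [psi j], so that one *)
(* class of test functions controls the cut norms at all indices.              *)
Lemma test_cut_small j (F : G -> R) (eta : R) :
  (forall phi, is_test phi -> `|avg (fun y => F y * phi y)| <= eta) ->
  cut_small j (fun x => F (psi j x)) eta.
Proof.
move=> Fsmall u ui u1; pose s := tperm j0 j.
(* [a i] converts the coefficients of [psi j] into those of [psi j0]; at [i = j] both vanish, and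
   any nonzero value would do. *)
pose a i : G := if i == j then 1 else ((s i)%:R - j0%:R) / (i%:R - j%:R).
have a0 i : a i != 0.
  rewrite /a; case: (eqVneq i j) => [_|ij]; first exact: oner_neq0.
  rewrite mulf_neq0 ?invr_eq0 ?coef_neq0//.
  by rewrite -[X in _ != X](tpermR j0 j) (inj_eq perm_inj).
pose T x : X := [ffun i => a i * x (s i)].
have Tbij : bijective T.
  apply: injF_bij => x y /ffunP xy; apply/ffunP => i.
  have := xy (s i); rewrite !ffunE tpermK; exact/mulfI.
have psiT x : psi j (T x) = psi j0 x.
  rewrite /psi [RHS](reindex_perm s); apply: eq_bigr => i _; rewrite ffunE.
  rewrite mulrA; congr (_ * _); rewrite /a; case: (eqVneq i j) => [->|ij].
    by rewrite tpermR !subrr mul0r.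
  by rewrite mulrC divfK// coef_neq0.
rewrite (avg_reindex _ Tbij).
have -> : avg ((fun x => F (psi j x) * others j u x) \o T)
    = avg (fun x => F (psi j0 x) * others j0 (fun i => u (s i) \o T) x).
  apply: eq_avg => x /=; rewrite psiT; congr (_ * _).
  rewrite /others (reindex_perm s); apply: eq_bigl => i.
  by rewrite -[X in _ != X](tpermL j0 j) (inj_eq perm_inj).
rewrite -[avg _]mul1r -avg_test; apply: Fsmall.
exists 1, (fun i => u (s i) \o T); split; rewrite ?normr1//;
  last by move=> i x; exact: u1.
move=> i ij x t.
have sij : s i != j by rewrite -[X in _ != X](tpermL j0 j) (inj_eq perm_inj).
rewrite /= -(ui _ sij (T x) (a (s i) * t)); congr (u _ _).
apply/ffunP => l; rewrite !ffunE.
by rewrite -(inj_eq (@perm_inj _ s)) tpermK; case: eqP => // <-.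
Qed.

End TestFunctions.

(** * Linear forms condition *)

Section CubeFormsFromLinearForms.
Variables (R : realType) (k : nat).

(** There are [k] choices of [j] and [2 ^ (k - 1)] sets avoiding it, exactly the number of forms
    that pseudorandomness allows. *)
Lemma card_admissible (X : {set 'I_k * {set 'I_k}}) :
  admissible X -> (#|X| <= k * 2 ^ (k - 1))%N.
Proof.
move=> aX; pose P := pairs [set: 'I_k] (fun i => ~: [set i]) (fun=> [set: 'I_k]).
apply: (@leq_trans #|P|).
  apply/subset_leq_card/fintype.subsetP => u uX; rewrite !inE andbT/=.
  by rewrite finset.subsetC finset.sub1set inE aX.
rewrite -sum1_card.
have -> : (\sum_(u in P) 1 = \sum_(i < k) \sum_(a in powerset (~: [set i])) 1)%N.
  by rewrite pair_big_dep/=; apply: eq_bigl => u; rewrite !inE andbT.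
rewrite (eq_bigr (fun=> 2 ^ (k - 1))%N) => [|i _].
  by rewrite sum_nat_const card_ord.
by rewrite sum1_card card_powerset cardsC1 card_ord subn1.
Qed.

(* [u = (j, a)] is encoded by its coefficients on the [k] differences          *)
(* [x1_i - x0_i] and on [\sum_i i x0_i] and [- \sum_i x0_i].                   *)
Definition form_coef (u : 'I_k * {set 'I_k}) (l : 'I_(k + 2)) : int :=
  match fintype.split l with
  | inl i => if i \in u.2 then i%:Z - u.1%:Z else 0
  | inr c => if c == 0 then 1 else u.1%:Z
  end.

Lemma form_coefl u i : form_coef u (lshift 2 i) = if i \in u.2 then i%:Z - u.1%:Z else 0.
Proof. by rewrite /form_coef -[lshift 2 i]/(unsplit (inl i)) unsplitK. Qed.

Lemma form_coefr u c : form_coef u (rshift k c) = if c == 0 then 1 else u.1%:Z.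
Proof. by rewrite /form_coef -[rshift k c]/(unsplit (inr c)) unsplitK. Qed.

Lemma form_coef_bound u l : (0 < k)%N -> `|form_coef u l| <= k%:Z.
Proof.
move=> k0; rewrite /form_coef; case: fintype.split => [i|c].
  case: ifP => _; last by rewrite normr0.
  have := ltn_ord i; have := ltn_ord u.1; lia.
case: ifP => _; first by rewrite normr1; lia.
by have := ltn_ord u.1; lia.
Qed.

Lemma form_coef_inj (u v : 'I_k * {set 'I_k}) : u.1 \notin u.2 -> v.1 \notin v.2 ->
  form_coef u =1 form_coef v -> u = v.
Proof.
move=> u12 v12 uv.
have uv1 : u.1 = v.1.
  by apply/val_inj; have := uv (rshift k 1); rewrite !form_coefr/= => -[].
have uv2 : u.2 = v.2.
  apply/setP => i; have := uv (lshift 2 i); rewrite !form_coefl uv1.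
  rewrite uv1 in u12.
  have [->|iv] := eqVneq i v.1; first by rewrite (negPf u12) (negPf v12).
  have : i%:Z - v.1%:Z != 0 by apply: contra iv; rewrite subr_eq0 => /eqP[/val_inj ->].
  by case: (i \in u.2); case: (i \in v.2) => // n0 E; rewrite -?E ?E eqxx in n0.
by rewrite [u]surjective_pairing [v]surjective_pairing uv1 uv2.
Qed.

Variable N : nat.
Notation G := 'F_N.
Implicit Types (z : {ffun 'I_k * bool -> G}).

Definition form_vars z : 'rV[G]_(k + 2) :=
  row_mx (\row_i (z (i, true) - z (i, false)))
    (\row_(c < 2) if c == 0 then \sum_(i < k) i%:R * z (i, false)
                  else - \sum_(i < k) z (i, false)).

Lemma form_vars_psi u z :
  \sum_l (form_coef u l)%:~R * form_vars z 0 l = psi u.1 (mix u.2 z).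
Proof.
rewrite big_split_ord/= !big_ord_recl big_ord0 addr0 /form_vars.
under eq_bigr do rewrite form_coefl row_mxEl mxE.
rewrite !form_coefr !row_mxEr !mxE/= mul1r mulrN !mulr_sumr -sumrB -big_split/=.
apply: eq_bigr => i _; rewrite ffunE; case: ifP => _.
  by rewrite rmorphB/= -!pmulrn; ring.
by rewrite mul0r -pmulrn; ring.
Qed.

Lemma avg_form_vars (F : 'rV[G]_(k + 2) -> R) : (1 < k)%N ->
  avg (F \o form_vars) = avg F.
Proof.
move=> k1; pose i1 : 'I_k := Ordinal k1; pose i0 : 'I_k := Ordinal (ltnW k1).
(* Coordinates 0 and 1 alone realize any prescribed values of [\sum_i i x0_i] and
   [- \sum_i x0_i]. *)
pose base (y : 'rV[G]_(k + 2)) i : G :=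
  if i == i1 then y 0 (rshift k 0)
  else if i == i0 then - y 0 (rshift k 1) - y 0 (rshift k 0) else 0.
pose s y : {ffun 'I_k * bool -> G} :=
  [ffun p => base y p.1 + if p.2 then y 0 (lshift 2 p.1) else 0].
have i01 : i0 != i1 by [].
have base_sum (c : 'I_k -> G) y : \sum_i c i * base y i = c i1 * y 0 (rshift k 0)
    + c i0 * (- y 0 (rshift k 1) - y 0 (rshift k 0)).
  rewrite (bigD1 i1)//= (bigD1 i0)//= big1 ?addr0 => [|i /andP[/negPf ii1 /negPf ii0]].
    by rewrite /base eqxx (negPf i01) eqxx.
  by rewrite /base ii1 ii0 mulr0.
apply: (avg_equidistributed (trX := fun y z => z + s y) (trY := fun y y' => y + y')).
- by apply/card_gt0P; exists 0.
- by move=> y; exact: addIr.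
- by move=> y a b /addIr.
- move=> z y; apply/rowP => l; rewrite [RHS]mxE /form_vars.
  rewrite -(fintype.splitK l); case: (fintype.split l) => [i|c] /=.
    by rewrite !row_mxEl !mxE !ffunE/=; ring.
  rewrite !row_mxEr !mxE; case: c => -[|[|//]] c2 /=.
    rewrite (_ : Ordinal c2 = 0); last exact/val_inj.
    under eq_bigr do rewrite !ffunE/= addr0 mulrDr.
    by rewrite big_split base_sum/=; ring.
  rewrite (_ : Ordinal c2 = 1); last exact/val_inj.
  under eq_bigr do rewrite !ffunE/= addr0.
  rewrite big_split/= opprD addrC; congr (_ + _).
  under eq_bigr do rewrite -[base _ _]mul1r.
  by rewrite base_sum; ring.
Qed.

(** Rewriting the [2k] coordinates as [k + 2] variables respects the limit [3k - 4], with equality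
    at [k = 3]. One column has all coefficients 1, so no row is zero and proportional rows are
    equal. *)
Lemma cube_forms_of_linear_forms (e : nat -> R) (nu : G -> R) :
  (3 <= k)%N -> (k < N)%N ->
  linear_forms_cond (k * 2 ^ (k - 1)) (3 * k - 4) k e nu ->
  cube_forms k nu (e N).
Proof.
move=> k3 kN lf X aX.
pose u (i : 'I_#|X|) := enum_val i.
pose L : 'M[rat]_(#|X|, k + 2) := \matrix_(i, l) (form_coef (u i) l)%:~R.
have k0 : (0 < k)%N by lia.
have uX i : (u i).1 \notin (u i).2 by apply/aX/enum_valP.
have rowL i i' (a : rat) : row i L = a *: row i' L ->
    forall l, (form_coef (u i) l)%:~R = a * (form_coef (u i') l)%:~R.
  by move=> /rowP E l; have := E l; rewrite !mxE.
have := lf kN #|X| (k + 2)%N (card_admissible aX) _ L _ _ _ (fun=> 0).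
under eq_avg do [under eq_bigr do [rewrite addr0; under eq_bigr do rewrite mxE ratr_int]].
rewrite -avg_form_vars; last by lia.
rewrite (eq_avg (G := fun z => \prod_(v in X) cube_value nu v z)); last first.
  move=> z /=; rewrite [RHS]big_enum_val/=; apply: eq_bigr => i _.
  by rewrite /cube_value -form_vars_psi.
apply; first by lia.
- move=> i l; rewrite mxE numq_int denq_int; split; first exact: form_coef_bound.
  by rewrite normr1; lia.
- move=> i; apply/eqP => /rowP /(_ (rshift k 0)).
  by rewrite !mxE form_coefr/= => /eqP; rewrite oner_eq0.
- move=> i i' ii' a; apply/eqP => /rowL E.
  have a1 : a = 1 by have := E (rshift k 0); rewrite !form_coefr/= mulr1.
  move/eqP: ii'; apply; apply: enum_val_inj.
  apply: form_coef_inj => [||l]; [exact: uX..|].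
  by have := E l; rewrite a1 mul1r => /eqP; rewrite eqr_int => /eqP.
Qed.

End CubeFormsFromLinearForms.

(** * Transference *)

Lemma ap_avg_psi (R : realType) (k N : nat) (f : 'F_N -> R) : (1 < k)%N ->
  avg (fun x : {ffun 'I_k -> 'F_N} => \prod_i f (psi i x)) = ap_avg k f.
Proof.
move=> k1; pose i1 : 'I_k := Ordinal k1; pose i0 : 'I_k := Ordinal (ltnW k1).
pose s (y : 'F_N * 'F_N) : {ffun 'I_k -> 'F_N} :=
  [ffun i => if i == i1 then y.1 else if i == i0 then - y.2 - y.1 else 0].
have s_sum (c : 'I_k -> 'F_N) y :
    \sum_i c i * s y i = c i1 * y.1 + c i0 * (- y.2 - y.1).
  rewrite (bigD1 i1)//= (bigD1 i0)//= big1 ?addr0 => [|i /andP[/negPf ii1 /negPf ii0]].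
    by rewrite !ffunE eqxx.
  by rewrite ffunE ii1 ii0 mulr0.
pose L (x : {ffun 'I_k -> 'F_N}) : 'F_N * 'F_N :=
  (\sum_(i < k) i%:R * x i, - \sum_(i < k) x i).
rewrite /ap_avg -(avg_equidistributed (L := L) (trX := fun y x => x + s y)
  (trY := fun y y' => (y.1 + y'.1, y.2 + y'.2))).
- apply: eq_avg => x; apply: eq_bigr => j _ /=; congr f.
  rewrite mulNrn -[X in _ - X]mulr_natl mulr_sumr -sumrB.
  by apply: eq_bigr => i _; rewrite mulrBl.
- by apply/card_gt0P; exists 0.
- by move=> y; exact: addIr.
- move=> y [a b] [a' b'] /eqP; rewrite xpair_eqE.
  by case/andP => /eqP/addIr /= -> /eqP/addIr /= ->.
- move=> x y; congr (_, _).
    under eq_bigr do rewrite ffunE mulrDr.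
    by rewrite big_split s_sum/= mul1r mul0r addr0 addrC.
  under eq_bigr do rewrite ffunE -[s y _]mul1r.
  by rewrite big_split s_sum/=; ring.
Qed.

Lemma Fp_natr_neq (N k : nat) (i j : 'I_k) : prime N -> (k < N)%N -> i != j ->
  i%:R - j%:R != 0 :> 'F_N.
Proof.
move=> pN kN; apply: contra; rewrite subr_eq0 => /eqP /(congr1 val).
rewrite /= !val_Fp_nat// !modn_small ?(ltn_trans (ltn_ord _))// => ij.
exact/eqP/val_inj.
Qed.

(** A dense model has mean at least [delta] only up to an error, while [szemeredi_constant] asks for
    [delta] itself. Moving [g] towards 1 restores the mean at an L1 cost equal to the deficit. *)
Lemma avg_raise (R : realType) (T : finType) (g : T -> R) (d eta : R) :
  (0 < #|T|)%N -> 0 <= eta -> d <= 1 -> (forall x, 0 <= g x <= 1) -> d - eta <= avg g ->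
  exists2 g' : T -> R, (forall x, 0 <= g' x <= 1) &
    d <= avg g' /\ avg (fun x => `|g x - g' x|) <= eta.
Proof.
move=> T0 eta0 d1 g01 gd; have [dg|gd'] := leP d (avg g).
  exists g => //; split => //.
  by rewrite (eq_avg (G := fun=> 0)) ?avg_cst// => x; rewrite subrr normr0.
pose t := (d - avg g) / (1 - avg g).
have m1 : 0 < 1 - avg g by rewrite subr_gt0 (lt_le_trans gd').
have t0 : 0 <= t by rewrite divr_ge0 ?subr_ge0 ?ltW// -subr_gt0.
have t1 : t <= 1 by rewrite ler_pdivrMr// mul1r lerD2r.
have tE : t * (1 - avg g) = d - avg g by rewrite divfK// gt_eqF.
have avg1g : avg (fun x => 1 - g x) = 1 - avg g by rewrite avgB avg_cst.
exists (fun x => g x + t * (1 - g x)) => [x|].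
  by have /andP[g0 g1] := g01 x; apply/andP; split; nra.
rewrite avgD avgZ avg1g tE; split; first by rewrite addrC subrK.
rewrite (eq_avg (G := fun x => t * (1 - g x))) => [|x].
  by rewrite avgZ avg1g tE; lra.
have /andP[_ g1] := g01 x.
by rewrite opprD addrA subrr add0r normrN ger0_norm// mulr_ge0// subr_ge0.
Qed.

Lemma transference (R : realType) (k : nat) (rho : R) : (3 <= k)%N -> 0 < rho ->
  exists2 eps : R, 0 < eps & forall (N : nat) (nu f : 'F_N -> R) (d : R),
  prime N -> (k < N)%N -> cube_forms k nu eps -> (forall x, 0 <= f x <= nu x) ->
  d <= 1 -> d <= avg f ->
  exists ft : 'F_N -> R, [/\ forall x, 0 <= ft x <= 1, d <= avg ft
    & `|ap_avg k f - ap_avg k ft| <= rho].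
Proof.
move=> k3 rho0; have [eta1 eta10 count] := counting_lemma k k rho0.
(* Half of [eta1] pays for the dense model, half for [avg_raise]. *)
have eta0 : 0 < eta1 / 2 by rewrite divr_gt0.
have [eta2 eta20 dense] := dense_model eta0.
have [eps /andP[eps0 eps1] small] := weighted_forms_small k eta20.
exists (Num.min eps eta1); first by rewrite lt_min eps0.
move=> N nu f d pN kN nuP fnu d1 df.
have nuPle e : Num.min eps eta1 <= e -> cube_forms k nu e.
  by move=> le_e U aU; exact: le_trans (nuP U aU) le_e.
have nuPe : cube_forms k nu eps by apply: nuPle; rewrite ge_min lexx.
have coef (i j : 'I_k) : i != j -> i%:R - j%:R != 0 :> 'F_N by exact: Fp_natr_neq.
have k1 : (1 < k)%N by exact: ltnW.
pose i1 : 'I_k := Ordinal k1; pose j0 : 'I_k := Ordinal (ltnW k1).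
have i1j0 : i1 != j0 by [].
have F0 : (0 < #|'F_N|)%N by apply/card_gt0P; exists 0.
pose Fam := @is_test R k 'F_N j0 i1.
(* The extra test [psi'] makes [Pr] closed under multiplication by tests: by [is_test_mul],
   [phi * psi'] is an average of tests. *)
pose Pr (g : 'F_N -> R) := forall psi', Fam psi' ->
  `|avg (fun y => (nu y - 1) * (g y * psi' y))| <= eta2.
have Fam1 : Fam (fun=> 1) by exact: is_test1.
have [||||g /(_ _ Fam1)|ft0 ft01 ft0P] := dense _ nu f Fam Pr F0 fnu Fam1.
- by move=> phi; exact: is_testN.
- by move=> phi x; exact: test_le1.
- move=> phi Fphi; under eq_avg do rewrite mul1r.
  apply: (test_nu_small coef i1j0) Fphi => s1 s2 a b; exact: small.
- move=> phi g Fphi Pg psi' Fpsi; have [w Fw wE] := is_test_mul Fphi Fpsi.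
  rewrite (eq_avg (G := fun y => avg (fun h => (nu y - 1) * (g y * w h y)))).
    rewrite avg_exchange; apply: avg_norm_le; [exact: ltW|] => h.
    exact/Pg/Fw.
  by move=> y; rewrite !avgZ -wE; ring.
- by under eq_avg do rewrite mulr1.
have ft0_avg : d - eta1 / 2 <= avg ft0.
  have := ft0P _ Fam1; under eq_avg do rewrite mulr1.
  by rewrite avgB ler_norml => /andP[_]; lra.
have [ft ft01' [ft_avg ft_ft0]] := avg_raise F0 (ltW eta0) d1 ft01 ft0_avg.
exists ft; split => //; rewrite -!(ap_avg_psi _ k1).
apply: (count 'F_N nu [set: 'I_k]) => //.
- by rewrite cardsT card_ord.
- by apply: nuPle; rewrite ge_min lexx orbT.
- by move=> i x t; rewrite psi_indep.
- by move=> i x t; rewrite psi_indep.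
- by move=> i x; rewrite /wt inE.
- move=> j _; apply: (test_cut_small coef i1j0 (F := fun y => f y - ft y)) => phi Fphi.
  rewrite (eq_avg (G := fun y => (f y - ft0 y) * phi y + (ft0 y - ft y) * phi y)).
    rewrite avgD; apply: le_trans (ler_normD _ _) _.
    rewrite [eta1]splitr lerD ?ft0P//; apply: le_trans (ler_norm_avg _) _.
    apply: le_trans ft_ft0; apply: le_avg => y.
    by rewrite normrM ler_piMr// (test_le1 _ Fphi).
  by move=> y; ring.
- by move=> i x; rewrite inE.
Qed.

Lemma vanishing_le (R : realType) (e : nat -> R) (rho : R) : vanishing e -> 0 < rho ->
  exists N0, forall N, (N0 <= N)%N -> e N <= rho.
Proof.
move=> /cvgrPdist_le e0 /e0[N0 _ N0P]; exists N0 => N /N0P/=.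
by rewrite sub0r normrN; exact: le_trans (ler_norm _).
Qed.

Local Open Scope classical_set_scope.

Theorem theorem3p5 (R : realType) (k : nat) (delta c : R)
    (hk : (3 <= k)%N) (hdelta : 0 < delta <= 1)
    (hc : szemeredi_constant k delta c)
    (e e' : nat -> R) (B : nat -> R -> R)
    (he : vanishing e) (he' : vanishing e') :
  exists2 eta : nat -> R, vanishing eta &
    forall N : nat, prime N ->
    forall nu : 'F_N -> R, pseudorandom k e e' B nu ->
    forall f : 'F_N -> R,
      (forall x, 0 <= f x <= nu x) -> delta <= avg f ->
      c - eta N <= ap_avg k f.
Proof.
case: hc => c0 [e1 e10 sz]; case/andP: hdelta => delta0 delta1.
(* The rate is the supremum of [c - ap_avg k f] over all data allowed at [N], which makes it
   uniform. Including 0 keeps the set nonempty for every [N] and the supremum nonnegative. *)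
pose defect N : set R := [set t | t = 0 \/ exists nu f : 'F_N -> R,
  [/\ prime N, pseudorandom k e e' B nu, forall x, 0 <= f x <= nu x,
      delta <= avg f & t = c - ap_avg k f]].
have defect0 N : defect N 0 by left.
have defect_le N : ubound (defect N) c.
  move=> t [->|[nu [f [_ _ fnu _ ->]]]]; first exact: ltW.
  rewrite gerBl; apply: avg_ge0 => x; apply: prodr_ge0 => j _.
  by case/andP: (fnu (x.1 + x.2 *+ j)).
have defect_sup N : has_sup (defect N) by split; [exists 0|exists c].
exists (fun N => sup (defect N)); last first.
  move=> N pN nu nuP f fnu df; rewrite lerBlDr -lerBlDl.
  by apply: ub_le_sup; [case: (defect_sup N)|right; exists nu, f].
apply/cvgrPdist_le => rho rho0.
have rho2 : 0 < rho / 2 by rewrite divr_gt0.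
have [eps eps0 tr] := transference hk rho2.
have [N1 N1P] := vanishing_le he' eps0.
have [N2 N2P] := vanishing_le e10 rho2.
exists (maxn k.+1 (maxn N1 N2)) => // N /=; rewrite !geq_max => /and3P[kN N1N N2N].
rewrite sub0r normrN ger0_norm; last by apply: ub_le_sup => //; case: (defect_sup N).
apply: ge_sup; first by exists 0.
move=> t [->|[nu [f [pN [_ lf _] fnu df ->]]]]; first exact: ltW.
have nuP : cube_forms k nu eps.
  move=> U aU; apply: le_trans (N1P _ N1N).
  exact: cube_forms_of_linear_forms lf _ aU.
have [ft [ft01 dft]] := tr N nu f delta pN kN nuP fnu delta1 df.
have := sz N pN ft ft01 dft; have := N2P _ N2N.
rewrite ler_norml; lra.
Qed.
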